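(* Let $r\ge 2$ and let $G$ be an $r$-partite graph with partition $V_1,V_2,\dots,V_r$ satisfying the following: (i) $|V_a|=n$ for all $1\le a\le r$; write $V_a=\{X_{a,1},\dots,X_{a,n}\}$; (ii) for all $1\le a,b\le r-1$ with $a\ne b$, the induced subgraph on the vertices $V_a\cup V_b$ is a complete bipartite graph (every vertex of $V_a$ is adjacent to every vertex of $V_b$); (iii) for all $1\le a\le r-1$, the induced subgraph on the vertices $V_a\cup V_r$ satisfies the Herzog-Hibi conditions with respect to these labelings. Then $G$ is Cohen-Macaulay.
   Context: $[m]=\{1,\dots,m\}$. Graphs are finite and simple. An $r$-partite graph with partition $V=V_1\cup\cdots\cup V_r$ (disjoint union) is a graph on $V$ in which no two vertices in the same $V_k$ are adjacent. For each $a\in[r-1]$, the induced bipartite graph on $V_a\cup V_r$, with $V_a=\{X_{a,1},\dots,X_{a,n}\}$ and $V_r=\{X_{r,1},\dots,X_{r,n}\}$, satisfies the Herzog-Hibi conditions if: (1) the two parts have the same cardinality; (2) $\{X_{a,i},X_{r,i}\}$ is an edge for all $i$; (3) if $\{X_{a,i},X_{r,j}\}$ is an edge, then $i\le j$; (4) if $\{X_{a,i},X_{r,j}\}$ and $\{X_{a,j},X_{r,k}\}$ are edges, then $\{X_{a,i},X_{r,k}\}$ is an edge. Let ${\sf k}$ be a field and let $S$ be the polynomial ring over ${\sf k}$ whose variables are the vertices of $G$. The edge ideal is $I(G)=\langle xy:\{x,y\}\text{ an edge of }G\rangle\subset S$. $G$ is called Cohen-Macaulay if $S/I(G)$ is a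 Cohen-Macaulay ring. *)

(* Defs.v *)
From HB Require Import structures.
From mathcomp Require Import all_boot all_order all_algebra ring_quotient.
From mathcomp Require Import generic_quotient.
From mathcomp Require Import boolp.
From mathcomp Require Import mpoly.
From mathcomp Require Import ring.

Set Implicit Arguments.
Unset Strict Implicit.
Unset Printing Implicit Defensive.

Import GRing.Theory.
Local Open Scope ring_scope.
Local Open Scope quotient_scope.

(* Localization R_P of a commutative ring at a prime ideal: classes of       *)
(* fractions x.1 / x.2 with x.2 outside P, where x ~ y when                  *)
(* s (x.1 y.2 - y.1 x.2) = 0 for some s outside P. The ring need not be a    *)
(* domain, so the factor s is needed.                                        *)
Module Localization.
Section Localization.
Variables (R : comNzRingType) (P : prime_idealr R).

Record fracAt := FracAt { frac :> R * R; fracP : frac.2 \notin P }.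

HB.instance Definition _ := [isSub for frac].
HB.instance Definition _ := [Choice of fracAt by <:].

Implicit Types x y z : fracAt.

Lemma notin_primeM (u v : R) : u \notin P -> v \notin P -> u * v \notin P.
Proof. by move=> Pu Pv; rewrite prime_idealrM negb_or Pu. Qed.

Lemma notin_prime1 : 1 \notin P.
Proof. by rewrite idealr1. Qed.

Definition equiv x y : bool :=
  `[< exists2 s, s \notin P & s * (x.1 * y.2 - y.1 * x.2) = 0 >].

Lemma equiv_refl : reflexive equiv.
Proof.
move=> x; apply/asboolP; exists 1; first exact: notin_prime1.
by rewrite subrr mulr0.
Qed.

Lemma equiv_symW x y : equiv x y -> equiv y x.
Proof.
move=> /asboolP[s Ps sxy]; apply/asboolP; exists s => //.
by rewrite -opprB mulrN sxy oppr0.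
Qed.

Lemma equiv_sym : ssrbool.symmetric equiv.
Proof. by move=> x y; apply/idP/idP; apply: equiv_symW. Qed.

Lemma equiv_trans : transitive equiv.
Proof.
move=> y x z /asboolP[s Ps sxy] /asboolP[t Pt tyz]; apply/asboolP.
exists (s * t * y.2); first by rewrite !notin_primeM // fracP.
have -> : s * t * y.2 * (x.1 * z.2 - z.1 * x.2) =
  t * z.2 * (s * (x.1 * y.2 - y.1 * x.2)) +
  s * x.2 * (t * (y.1 * z.2 - z.1 * y.2)) by ring.
by rewrite sxy tyz !mulr0 addr0.
Qed.

Canonical equiv_equiv := EquivRel equiv equiv_refl equiv_sym equiv_trans.

Definition type := {eq_quot equiv}.

HB.instance Definition _ : EqQuotient _ equiv type := EqQuotient.on type.
HB.instance Definition _ := Choice.on type.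

Lemma piP x y : reflect (exists2 s, s \notin P & s * (x.1 * y.2 - y.1 * x.2) = 0)
  (x == y %[mod type]).
Proof. by rewrite eqmodE; apply: asboolP. Qed.

Lemma repr_piP x :
  exists2 s, s \notin P &
    s * (x.1 * (repr (\pi_type x)).2 - (repr (\pi_type x)).1 * x.2) = 0.
Proof. by apply/piP; rewrite reprK. Qed.

Definition num_den (a d : R) (Pd : d \notin P) : fracAt := @FracAt (a, d) Pd.

Definition embed (a : R) : fracAt := num_den a notin_prime1.
Definition addf x y : fracAt :=
  num_den (x.1 * y.2 + y.1 * x.2) (notin_primeM (fracP x) (fracP y)).
Definition oppf x : fracAt := num_den (- x.1) (fracP x).
Definition mulf x y : fracAt :=
  num_den (x.1 * y.1) (notin_primeM (fracP x) (fracP y)).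

Definition tolocal := lift_embed type embed.
Canonical tolocal_pi_morph := PiEmbed tolocal.

Definition add := lift_op2 type addf.
Lemma pi_add : {morph \pi : x y / addf x y >-> add x y}.
Proof.
move=> x y; unlock add; apply/eqP/piP => /=.
have [s Ps Es] := repr_piP x; have [t Pt Et] := repr_piP y.
move: (repr (\pi x)) (repr (\pi y)) Es Et => x' y' Es Et.
exists (s * t); first exact: notin_primeM.
transitivity (t * y.2 * y'.2 * (s * (x.1 * x'.2 - x'.1 * x.2)) +
  s * x.2 * x'.2 * (t * (y.1 * y'.2 - y'.1 * y.2))); first by ring.
by rewrite Es Et !mulr0 addr0.
Qed.
Canonical pi_add_morph := PiMorph2 pi_add.

Definition opp := lift_op1 type oppf.
Lemma pi_opp : {morph \pi : x / oppf x >-> opp x}.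
Proof.
move=> x; unlock opp; apply/eqP/piP => /=.
have [s Ps Es] := repr_piP x; exists s => //.
by rewrite !mulNr -opprD mulrN Es oppr0.
Qed.
Canonical pi_opp_morph := PiMorph1 pi_opp.

Definition mul := lift_op2 type mulf.
Lemma pi_mul : {morph \pi : x y / mulf x y >-> mul x y}.
Proof.
move=> x y; unlock mul; apply/eqP/piP => /=.
have [s Ps Es] := repr_piP x; have [t Pt Et] := repr_piP y.
move: (repr (\pi x)) (repr (\pi y)) Es Et => x' y' Es Et.
exists (s * t); first exact: notin_primeM.
transitivity (t * y.1 * y'.2 * (s * (x.1 * x'.2 - x'.1 * x.2)) +
  s * x'.1 * x.2 * (t * (y.1 * y'.2 - y'.1 * y.2))); first by ring.
by rewrite Es Et !mulr0 addr0.
Qed.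
Canonical pi_mul_morph := PiMorph2 pi_mul.

Lemma pi_eq x y : x.1 * y.2 = y.1 * x.2 -> x = y %[mod type].
Proof.
move=> Exy; apply/eqP/piP; exists 1; first exact: notin_prime1.
by rewrite Exy subrr mulr0.
Qed.

Lemma addA : associative add.
Proof.
elim/quotW=> x; elim/quotW=> y; elim/quotW=> z; rewrite !piE.
by apply: pi_eq => /=; ring.
Qed.

Lemma addC : commutative add.
Proof.
by elim/quotW=> x; elim/quotW=> y; rewrite !piE; apply: pi_eq => /=; ring.
Qed.

Lemma add0 : left_id (tolocal 0) add.
Proof. by elim/quotW=> x; rewrite !piE; apply: pi_eq => /=; ring. Qed.

Lemma addN : left_inverse (tolocal 0) opp add.
Proof. by elim/quotW=> x; rewrite !piE; apply: pi_eq => /=; ring. Qed.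

HB.instance Definition _ := GRing.isZmodule.Build type addA addC add0 addN.

Lemma mulA : associative mul.
Proof.
elim/quotW=> x; elim/quotW=> y; elim/quotW=> z; rewrite !piE.
by apply: pi_eq => /=; ring.
Qed.

Lemma mulC : commutative mul.
Proof.
by elim/quotW=> x; elim/quotW=> y; rewrite !piE; apply: pi_eq => /=; ring.
Qed.

Lemma mul1 : left_id (tolocal 1) mul.
Proof. by elim/quotW=> x; rewrite !piE; apply: pi_eq => /=; ring. Qed.

Lemma mul_addl : left_distributive mul add.
Proof.
elim/quotW=> x; elim/quotW=> y; elim/quotW=> z; rewrite !piE.
by apply: pi_eq => /=; ring.
Qed.

Lemma nonzero1 : tolocal 1 != tolocal 0.
Proof.
rewrite !piE; apply/negP => /asboolP[s Ps /= s0]; move: Ps.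
by rewrite (_ : s = 0) ?idealr0 // -s0; ring.
Qed.

HB.instance Definition _ :=
  GRing.Zmodule_isComNzRing.Build type mulA mulC mul1 mul_addl nonzero1.

End Localization.
End Localization.
HB.export Localization.

Notation localization P := (@Localization.type _ P).

Section CommutativeAlgebra.
Variable R : comNzRingType.

Definition ideal_span (G : R -> Prop) (x : R) : Prop :=
  exists2 s : seq (R * R), (forall p, p \in s -> G p.2) &
    x = \sum_(p <- s) p.1 * p.2.

(* [idealr R] consists of the proper ideals; the unit ideal is always        *)
(* finitely generated.                                                       *)
Definition noetherian : Prop :=
  forall I : idealr R, exists s : seq R,
    forall x, x \in I <-> ideal_span (fun y => y \in s) x.

Definition maximal_ideal (M : idealr R) : Prop :=
  forall J : idealr R, {subset M <= J} -> M =i J.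

Definition local_ring (M : idealr R) : Prop :=
  maximal_ideal M /\ forall J : idealr R, maximal_ideal J -> J =i M.

Definition prime_chain (d : nat) (c : 'I_d.+1 -> prime_idealr R) : Prop :=
  forall i j : 'I_d.+1, (i < j)%N ->
    {subset c i <= c j} /\ exists2 x, x \in c j & x \notin c i.

Definition krull_dim (d : nat) : Prop :=
  (exists c, @prime_chain d c) /\
  forall d' c, @prime_chain d' c -> (d' <= d)%N.

Definition regular_sequence (s : seq R) : Prop :=
  (forall i x, (i < size s)%N ->
    ideal_span (fun y => y \in take i s) (s`_i * x) ->
    ideal_span (fun y => y \in take i s) x) /\
  ~ ideal_span (fun y => y \in s) 1.

(* Length of a longest regular sequence contained in M; used for the maximal  *)
(* ideal of a local ring.                                                    *)
Definition depth (M : idealr R) (d : nat) : Prop :=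
  (exists s, [/\ regular_sequence s, {subset s <= M} & size s = d]) /\
  forall s, regular_sequence s -> {subset s <= M} -> (size s <= d)%N.

Definition cohen_macaulay_local : Prop :=
  exists (M : idealr R) (d : nat),
    [/\ local_ring M, depth M d & krull_dim d].

End CommutativeAlgebra.

(* Maximal ideals are prime, so M ranges over all maximal ideals of R; the    *)
(* bundling as [prime_idealr] is what localization requires.                 *)
Definition cohen_macaulay (R : comNzRingType) : Prop :=
  noetherian R /\
  forall M : prime_idealr R, maximal_ideal M ->
    cohen_macaulay_local (localization M).

Section EdgeIdeal.
Variables (k : fieldType) (V : finType) (e : rel V).

(* The variable attached to the vertex v is the one of index [enum_rank v].  *)
Definition edge_monomial (p : {mpoly k[#|V|]}) : Prop :=
  exists u v : V, e u v /\ p = 'X_(enum_rank u) * 'X_(enum_rank v).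

Definition in_edge_ideal : {mpoly k[#|V|]} -> bool :=
  fun p => `[< ideal_span edge_monomial p >].

Lemma in_edge_ideal_closed : idealr_closed in_edge_ideal.
Proof.
split.
- by apply/asboolP; exists [::] => //; rewrite big_nil.
- apply/negP => /asboolP[s sG]; move/(congr1 (mcoeff 0%MM)).
  rewrite mcoeff1 eqxx raddf_sum /= big_seq big1 => [/eqP|p /sG].
    by rewrite oner_eq0.
  move=> [u [v [_ ->]]].
  by rewrite !rmorphM /= !mcoeffX !mnm1_eq0 /= !mulr0.
move=> a p q /asboolP[s sG ->] /asboolP[t tG ->]; apply/asboolP.
exists ([seq (a * x.1, x.2) | x <- s] ++ t).
  by move=> x; rewrite mem_cat => /orP[/mapP[y /sG Gy ->]|/tG].
rewrite big_cat big_map mulr_sumr; congr (_ + _).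
by apply: eq_bigr => x _; rewrite mulrA.
Qed.

HB.instance Definition _ :=
  isIdealr.Build {mpoly k[#|V|]} in_edge_ideal in_edge_ideal_closed.

Definition edge_ideal : idealr {mpoly k[#|V|]} := in_edge_ideal.

Definition cohen_macaulay_graph : Prop :=
  cohen_macaulay {ideal_quot edge_ideal}.

End EdgeIdeal.

Section Graphs.
Variables (V : finType) (e : rel V).

Definition simple_graph : Prop := ssrbool.symmetric e /\ irreflexive e.

Definition multipartite (r : nat) (P : 'I_r -> {set V}) : Prop :=
  [/\ \bigcup_a P a = [set: V],
      forall a b, a != b -> [disjoint P a & P b] &
      forall a u v, u \in P a -> v \in P a -> ~~ e u v].

Definition labels (n : nat) (A : {set V}) (x : 'I_n -> V) : Prop :=
  injective x /\ A = [set x i | i : 'I_n].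

Definition herzog_hibi (n : nat) (A B : {set V}) (x y : 'I_n -> V) : Prop :=
  [/\ #|A| = #|B|,
      forall i, e (x i) (y i),
      forall i j, e (x i) (y j) -> (i <= j)%N &
      forall i j l, e (x i) (y j) -> e (x j) (y l) -> e (x i) (y l)].

End Graphs.

(* Main.v *)
From HB Require Import structures.
Require Import Defs.
From mathcomp Require Import all_boot all_order all_algebra.
From mathcomp Require Import ring_quotient generic_quotient boolp.
From mathcomp Require classical_sets.
From mathcomp Require Import mpoly ring zify.

(** The edge ring S/I(G) is a finite free module over the polynomial ring
    A = k[t_1, ..., t_n], where t_i acts as theta_i, the sum of the vertices
    X_{1,i}, ..., X_{r,i}; a ring that is finite and free over a polynomial ring
    is Cohen-Macaulay.

    Freeness. For each i the vertices X_{1,i}, ..., X_{r,i}, those of colour i,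
    form a clique, and an independent set lies in the union of V_a and V_r for a
    single a < r. For a < r the relation
    X_{a,i} <= X_{a,j} iff {X_{a,i}, X_{r,j}} is an edge is a partial order, by
    the Herzog-Hibi conditions. The facets of the independence complex are
    indexed by the antichains C of these orders: the facet of C consists of the
    up-closure of C together with the X_{r,j} whose colour is not used by this
    up-closure. It has exactly one vertex of each colour, so that
    sending the vertices of the facet to the t_i of their colours, and all the
    others to 0, is a retraction rho_C of S/I(G) onto A ([facet_retraction]).
    The products m_C of the vertices of C form the basis. Independence holds
    because rho_C (m_D) vanishes unless D is C or has a smaller up-closure
    ([antichain_eq]). For generation, let x^m be a monomial with independent
    support T, and C the set of minimal elements of T outside V_r. If
    x^m is not m_C then x^m = x^m' x_v with C still in the support of m', and
    x^m = theta_i x^m' minus the sum of the x^m' x_w for the other vertices w of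
    the colour i of v, and each of these products is in I(G) or has a larger
    up-closure ([exchange]).
    Induction on the up-closure and on the degree concludes
    ([edge_ring_spanned]).

    From freeness to the Cohen-Macaulay property
    ([triangularly_free_cohen_macaulay]). Let M be a maximal ideal of such a ring
    R. By Zariski's lemma M contains a monic polynomial f_i (theta_i) for each i
    ([maximal_ideal_monic]). The f_i (t_i) form a regular sequence in A, hence in
    R and in R_M by freeness and flatness ([at_var_weakly_regular],
    [weakly_regular_tolocal]). A regular sequence in a prime ideal produces a
    chain of primes of the same length ([regular_sequence_prime_chain]). In the
    other direction, n + 1 elements of R are algebraically dependent over k, by
    counting monomials ([algebraic_dependence]), whereas a chain of primes of
    length n + 1 would give independent elements
    ([prime_chain_independent]). So n bounds the lengths of the prime chains of
    R_M and of its regular sequences, and both bounds are attained. Finally R is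
    noetherian by Hilbert's basis theorem ([fg_ideals_generated]). *)

Set Implicit Arguments.
Unset Strict Implicit.
Unset Printing Implicit Defensive.

Import GRing.Theory.
Local Open Scope ring_scope.
Local Open Scope quotient_scope.

(** * Ideals, quotients, primes and regular sequences *)

Section Ideals.
Variable R : comNzRingType.
Implicit Types (J T G : R -> Prop) (x y a : R).

(** Unlike [idealr], the unit ideal is allowed, so that spans and sums of ideals
    are ideals without side condition. *)
Definition is_ideal J : Prop :=
  [/\ J 0, forall x y, J x -> J y -> J (x + y) & forall a x, J x -> J (a * x)].

Lemma ideal_span_ideal G : is_ideal (ideal_span G).
Proof.
split.
- by exists [::] => //; rewrite big_nil.
- move=> x y [s sG ->] [t tG ->]; exists (s ++ t).
    by move=> p; rewrite mem_cat => /orP[/sG|/tG].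
  by rewrite big_cat.
- move=> a x [s sG ->]; exists [seq (a * p.1, p.2) | p <- s].
    by move=> p /mapP[q /sG Gq ->].
  by rewrite big_map mulr_sumr; apply: eq_bigr => p _; rewrite mulrA.
Qed.

Lemma mem_ideal_span G x : G x -> ideal_span G x.
Proof.
move=> Gx; exists [:: (1, x)]; last by rewrite big_seq1 mul1r.
by move=> p; rewrite inE => /eqP ->.
Qed.

Lemma is_ideal_sum J (I : eqType) (r : seq I) (F : I -> R) :
  is_ideal J -> (forall i, i \in r -> J (F i)) -> J (\sum_(i <- r) F i).
Proof.
move=> [J0 JD _] JF; rewrite big_seq.
by elim/big_rec: _ => // i x ir Jx; apply: JD => //; apply: JF.
Qed.

Lemma ideal_span_min G J x :
  is_ideal J -> (forall y, G y -> J y) -> ideal_span G x -> J x.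
Proof.
move=> idJ GJ [s sG ->]; apply: is_ideal_sum => // p /sG /GJ.
by case: idJ => _ _; apply.
Qed.

Lemma ideal_span_mono G G' x :
  (forall y, G y -> G' y) -> ideal_span G x -> ideal_span G' x.
Proof.
move=> GG'; apply: ideal_span_min; first exact: ideal_span_ideal.
by move=> y /GG'; apply: mem_ideal_span.
Qed.

Lemma is_idealB J x y : is_ideal J -> J x -> J y -> J (x - y).
Proof. by case=> J0 JD JM Jx Jy; rewrite -mulN1r; apply: JD => //; apply: JM. Qed.

Lemma idealr_is_ideal (I : idealr R) : is_ideal (fun x => x \in I).
Proof.
by split=> [|x y|a x]; [exact: idealr0 | exact: rpredD | exact: idealMr].
Qed.

Lemma is_ideal_idealr J :
  is_ideal J -> ~ J 1 -> exists I : idealr R, forall x, x \in I <-> J x.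
Proof.
move=> [J0 JD JM] J1; pose f x := `[< J x >].
have fP : idealr_closed (f : {pred R}).
  split; rewrite ?unfold_in; first exact/asboolP.
    exact/asboolP.
  by move=> a u v /asboolP Ju /asboolP Jv; apply/asboolP/JD => //; apply: JM.
pose I : idealr R := HB.pack f (isIdealr.Build R f fP).
by exists I => x; split=> [/asboolP|Jx]; last exact/asboolP.
Qed.

Lemma is_ideal_prime_idealr J :
  is_ideal J -> ~ J 1 -> (forall x y, J (x * y) -> J x \/ J y) ->
  exists I : prime_idealr R, forall x, x \in I <-> J x.
Proof.
move=> [J0 JD JM] J1 Jp; pose f x := `[< J x >].
have fP : idealr_closed (f : {pred R}).
  split; rewrite ?unfold_in; first exact/asboolP.
    exact/asboolP.
  by move=> a u v /asboolP Ju /asboolP Jv; apply/asboolP/JD => //; apply: JM.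
have fpP : prime_idealr_closed (f : {pred R}).
  by move=> x y /asboolP/Jp[] Jx; apply/orP; [left|right]; apply/asboolP.
pose I : prime_idealr R := HB.pack f (isIdealr.Build R f fP)
  (isPrimeIdealrClosed.Build R f fpP).
by exists I => x; split=> [/asboolP|Jx]; last exact/asboolP.
Qed.

Lemma is_ideal_adjoin J x :
  is_ideal J -> is_ideal (fun z => exists u a, J u /\ z = u + a * x).
Proof.
move=> [J0 JD JM]; split.
- by exists 0, 0; rewrite mul0r addr0.
- move=> _ _ [u [a [Ju ->]]] [v [b [Jv ->]]]; exists (u + v), (a + b).
  by split; [exact: JD | ring].
- move=> c _ [u [a [Ju ->]]]; exists (c * u), (c * a).
  by split; [exact: JM | ring].
Qed.

(** An ideal maximal among those that contain J and miss the multiplicative set T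
    is prime: if x and y are outside it, then both enlarged ideals meet T, and
    the product of the two elements of T found there shows that x y is outside
    as well. *)
Lemma prime_avoiding J T :
  is_ideal J -> T 1 -> (forall x y, T x -> T y -> T (x * y)) ->
  (forall x, J x -> ~ T x) ->
  exists p : prime_idealr R,
    (forall x, J x -> x \in p) /\ (forall x, T x -> x \notin p).
Proof.
move=> idJ T1 TM JT.
pose good A := [/\ is_ideal A, forall x, J x -> A x & forall x, A x -> ~ T x].
have gJ : good J by split.
(* The empty set is added to the family because it is the union of the empty
   chain. *)
pose P A := (forall x, ~ A x) \/ good A.
have [F FP Ftot|A [PA Amax]] := @classical_sets.Zorn_bigcup R P.
  have [[A FA [x0 Ax0]]|noF] := EM (exists2 A, F A & exists x, A x); last first.
    by left=> x [A FA Ax]; apply: noF; exists A => //; exists x.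
  right; have gF B x : F B -> B x -> good B.
    by move=> /FP[B0 /B0|].
  have [[A0 AD AM] JA _] := gF A x0 FA Ax0.
  split.
  - split; first by exists A.
      move=> x y [B FB Bx] [C FC Cy].
      have [BC|CB] := Ftot _ _ FB FC.
        have [[_ CD _] _ _] := gF C y FC Cy.
        by exists C => //; apply: CD => //; apply: BC.
      have [[_ BD _] _ _] := gF B x FB Bx.
      by exists B => //; apply: BD => //; apply: CB.
    move=> a x [B FB Bx]; exists B => //.
    by have [[_ _ BM] _ _] := gF B x FB Bx; apply: BM.
  - by move=> x Jx; exists A => //; apply: JA.
  - by move=> x [B FB Bx]; have [_ _] := gF B x FB Bx; apply.
have gA : good A.
  case: PA => // A0; case: (Amax J); last by right.
  split; first by move=> x /A0.
  by move=> /(_ 0) JA; case: idJ => J0 _ _; apply: (A0 0); apply: JA.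
have [idA JA AT] := gA; have [A0 AD AM] := idA.
have bigger x : ~ A x -> exists u a, A u /\ T (u + a * x).
  move=> nAx; apply: contrapT => noT.
  apply: (Amax (fun z => exists u a, A u /\ z = u + a * x)).
    split; first by move=> z Az; exists z, 0; rewrite mul0r addr0.
    move=> /(_ x); apply: contra_not nAx => /(_ _); apply.
    by exists 0, 1; rewrite mul1r add0r.
  right; split; first exact: is_ideal_adjoin.
    by move=> z /JA Az; exists z, 0; rewrite mul0r addr0.
  by move=> z [u [a [Au ->]]] Tz; apply: noT; exists u, a.
have [|x y Axy|p pA] := is_ideal_prime_idealr idA.
- by move=> /AT.
- apply: contrapT => /not_orP[/bigger[u [a [Au Tu]]] /bigger[v [b [Av Tv]]]].
  apply: (AT ((u + a * x) * (v + b * y))); last exact: TM.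
  have -> : (u + a * x) * (v + b * y) =
    (v + b * y) * u + (a * x) * v + (a * b) * (x * y) by ring.
  by apply: (AD); [apply: (AD); apply: AM | apply: AM].
- exists p; split=> x; first by move=> /JA /pA.
  by move=> Tx; apply/negP => /pA /AT.
Qed.

(** Going down: if q is a prime containing s_0, ..., s_j, the elements s_j^m u
    with u outside q avoid the ideal (s_0, ..., s_{j-1}), by regularity of s_j, so
    there is a prime q' between this ideal and q that misses s_j; hence q' is
    strictly smaller than q. *)
Lemma regular_sequence_prime_chain (p : prime_idealr R) (s : seq R) :
  regular_sequence s -> {subset s <= p} ->
  exists c, @prime_chain R (size s) c.
Proof.
move=> [reg _] sp.
suff chain j : (j <= size s)%N -> forall q : prime_idealr R,
    {subset take j s <= q} -> exists c : nat -> prime_idealr R,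
    c j = q /\ forall i, (i < j)%N ->
      {subset c i <= c i.+1} /\ exists2 x, x \in c i.+1 & x \notin c i.
  have [|c [_ cP]] := chain _ (leqnn _) p; first by rewrite take_size.
  exists (fun i => c i) => i j ltij; have := ltn_ord j; rewrite ltnS => lej.
  have sub (a b : nat) : (a <= b <= size s)%N -> {subset c a <= c b}.
    elim: b => [|b IHb] /andP[]; first by rewrite leqn0 => /eqP -> _ x.
    rewrite leq_eqVlt => /predU1P[-> _ x //|]; rewrite ltnS => leab ltb x xa.
    by apply: (cP b ltb).1; apply: IHb => //; rewrite leab ltnW.
  split; first by apply: sub; rewrite (ltnW ltij).
  have [|_ [x xi nxi]] := cP i; first exact: leq_trans lej.
  by exists x => //; apply: sub xi; rewrite ltij.
elim: j => [|j IHj] lej q qs; first by exists (fun=> q).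
pose J := ideal_span (fun y => y \in take j s).
have qJ x : J x -> x \in q.
  apply: (ideal_span_min (idealr_is_ideal q)) => y yj; apply: qs.
  by rewrite (take_nth 0) // mem_rcons inE yj orbT.
pose T x := exists u m, u \notin q /\ x = s`_j ^+ m * u.
have [||x y|x Jx [u [m [nqu xE]]]|q' [Jq' Tq']] := @prime_avoiding J T.
- exact: ideal_span_ideal.
- by exists 1, 0; rewrite expr0 mulr1 idealr1.
- move=> [u [m [nqu ->]]] [v [l [nqv ->]]]; exists (u * v), (m + l)%N.
  by split; [rewrite prime_idealrM negb_or nqu | rewrite exprD; ring].
- suff /qJ qu : J u by rewrite qu in nqu.
  rewrite {}xE in Jx; elim: m Jx => [|m IHm]; first by rewrite expr0 mul1r.
  by rewrite exprS -mulrA => /(reg _ _ lej); apply: IHm.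
have [||c [cj cP]] := IHj _ q'; first exact: ltnW.
  by move=> x xj; apply: Jq'; apply: mem_ideal_span.
exists (fun i => if (i <= j)%N then c i else q); rewrite ltnn; split=> // i /=.
rewrite ltnS => leij; rewrite leij.
case: ltnP => [ltij|leji]; first exact: cP.
have -> : i = j by apply/eqP; rewrite eqn_leq leij.
rewrite cj; split=> [x|].
  apply: contraTT => nqx; apply: Tq'; exists x, 0.
  by rewrite expr0 mul1r.
exists s`_j; first by apply: qs; rewrite (take_nth 0) // mem_rcons inE eqxx.
by apply: Tq'; exists 1, 1; rewrite expr1 mulr1 idealr1.
Qed.

End Ideals.

Lemma rmorphism_quot_factor (R S : comNzRingType) (I : idealr R)
    (g : {rmorphism R -> S}) :
  (forall x, x \in I -> g x = 0) ->
  exists gI : {rmorphism {ideal_quot I} -> S}, forall x, gI (\pi x) = g x.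
Proof.
move=> gI0; pose h (x : {ideal_quot I}) := g (repr x).
have hE x : h (\pi x) = g x.
  apply/eqP; rewrite -subr_eq0 -rmorphB; apply/eqP/gI0.
  by rewrite Quotient.idealrBE reprK.
have hB : zmod_morphism h.
  elim/quotW => x; elim/quotW => y.
  by rewrite -rmorphB /= !hE rmorphB.
have hM : monoid_morphism h.
  split; first by rewrite -(rmorph1 \pi_{ideal_quot I}) /= hE rmorph1.
  elim/quotW => x; elim/quotW => y.
  by rewrite -rmorphM /= !hE rmorphM.
pose h' : {rmorphism {ideal_quot I} -> S} := HB.pack h
  (GRing.isZmodMorphism.Build _ _ h hB) (GRing.isMonoidMorphism.Build _ _ h hM).
by exists h'.
Qed.

(** * Hilbert's basis theorem *)

(** The noetherian condition for ideals that need not be proper. *)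
Definition fg_ideals (R : comNzRingType) : Prop :=
  forall J : R -> Prop, is_ideal J -> exists s : seq R,
    (forall y, y \in s -> J y) /\ forall x, J x -> ideal_span (fun y => y \in s) x.

Lemma fg_ideals_noetherian (R : comNzRingType) : fg_ideals R -> noetherian R.
Proof.
move=> fgR I; have [s [sI Is]] := fgR _ (idealr_is_ideal I).
exists s => x; split; first exact: Is.
exact: ideal_span_min (idealr_is_ideal I) sI.
Qed.

Lemma seq_choice (T U : eqType) (s : seq T) (Q : T -> U -> Prop) :
  (forall x, x \in s -> exists y, Q x y) ->
  exists t : seq U, (forall y, y \in t -> exists2 x, x \in s & Q x y) /\
    (forall x, x \in s -> exists2 y, y \in t & Q x y).
Proof.
elim: s => [|a s IHs] sQ; first by exists [::].
have [|t [ts st]] := IHs; first by move=> x xs; apply: sQ; rewrite inE xs orbT.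
have [b Qab] := sQ a (mem_head _ _); exists (b :: t); split=> x.
  rewrite inE => /predU1P[->|/ts[y ys Qyx]]; first by exists a; rewrite ?mem_head.
  by exists y; rewrite // inE ys orbT.
rewrite inE => /predU1P[->|/st[y ys Qyx]]; first by exists b; rewrite ?mem_head.
by exists y; rewrite // inE ys orbT.
Qed.

(** For an ideal J of B[X], [lead d] is the ideal of the coefficients of degree d
    of the elements of J of degree at most d. These ideals increase with d; a
    finite generating set of their union lives in some degree D, and lifting
    generators of [lead 0], ..., [lead D.-1] and of this union to J gives
    generators of J. *)
Section HilbertBasis.
Variables (B : comNzRingType) (fgB : fg_ideals B).
Variables (J : {poly B} -> Prop) (idJ : is_ideal J).

Let lead d (c : B) := exists p, [/\ J p, (size p <= d.+1)%N & p`_d = c].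
Let coefs (G : seq {poly B}) d (c : B) := exists2 q, q \in G & c = q`_d.
Let spans (G : seq {poly B}) d e :=
  [/\ forall q, q \in G -> J q, forall q, q \in G -> (size q <= d.+1)%N &
      forall p, J p -> (size p <= e.+1)%N -> ideal_span (coefs G d) p`_e].

Local Lemma lead_ideal d : is_ideal (lead d).
Proof.
have [J0 JD JM] := idJ; split.
- by exists 0; rewrite size_poly0 coef0.
- move=> _ _ [p [Jp sp <-]] [q [Jq sq <-]]; exists (p + q); rewrite coefD.
  by split; [exact: JD | rewrite (leq_trans (size_polyD _ _)) // geq_max sp |].
- move=> a _ [p [Jp sp <-]]; exists (a *: p); rewrite coefZ; split=> //.
    by rewrite -mul_polyC; apply: JM.
  exact: leq_trans (size_scale_leq _ _) sp.
Qed.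

Local Lemma lead_le d e c : (d <= e)%N -> lead d c -> lead e c.
Proof.
have [_ _ JM] := idJ; move=> /subnKC <-; elim: (e - d)%N => [|m IHm].
  by rewrite addn0.
move=> /IHm[p [Jp sp <-]]; rewrite addnS; exists ('X * p).
rewrite coefXM /=; split=> //; first exact: JM.
by apply: leq_trans (size_polyMleq _ _) _; rewrite size_polyX.
Qed.

Local Lemma lead_gens d (s : seq B) : (forall c, c \in s -> lead d c) ->
  exists G : seq {poly B},
  [/\ forall q, q \in G -> J q, forall q, q \in G -> (size q <= d.+1)%N &
      forall c, c \in s -> coefs G d c].
Proof.
move=> /(seq_choice (Q := fun c p => [/\ J p, (size p <= d.+1)%N & p`_d = c])).
case=> G [Gs sG]; exists G; split=> q; try by move=> /Gs[? _ []].
by move=> /sG[p pG [_ _ pq]]; exists p.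
Qed.

Local Lemma spans_level d : exists G, spans G d d.
Proof.
have [s [sL Ls]] := fgB (lead_ideal d).
have [G [GJ Gd sG]] := lead_gens sL; exists G; split=> // p Jp sp.
by apply: ideal_span_mono sG _; apply: Ls; exists p.
Qed.

Local Lemma spans_above : exists G D, forall e, (D <= e)%N -> spans G D e.
Proof.
have idL : is_ideal (fun c => exists d, lead d c).
  split; first by exists 0; case: (lead_ideal 0).
    move=> x y [d Lx] [e Ly]; exists (maxn d e).
    case: (lead_ideal (maxn d e)) => _ LD _; apply: LD.
      by apply: lead_le Lx; apply: leq_maxl.
    by apply: lead_le Ly; apply: leq_maxr.
  by move=> a x [d Lx]; exists d; case: (lead_ideal d) => _ _; apply.
have [s [sL Ls]] := fgB idL.
have [D sLD] : exists D, forall c, c \in s -> lead D c.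
  elim: s sL {Ls} => [|a s IHs] sL; first by exists 0.
  have [|D sD] := IHs; first by move=> y ys; apply: sL; rewrite inE ys orbT.
  have [d Ld] := sL a (mem_head _ _).
  exists (maxn d D) => c; rewrite inE => /predU1P[->|/sD Lc].
    by apply: lead_le Ld; apply: leq_maxl.
  by apply: lead_le Lc; apply: leq_maxr.
have [G [GJ GD sG]] := lead_gens sLD; exists G, D => e _; split=> // p Jp sp.
by apply: ideal_span_mono sG _; apply: Ls; exists e, p.
Qed.

Local Lemma poly_reduce G d e p : spans G d e -> (d <= e)%N -> J p ->
  (size p <= e.+1)%N ->
  exists q, [/\ ideal_span (fun y => y \in G) q, J (p - q) & (size (p - q)%R <= e)%N].
Proof.
move=> [GJ Gd Ge] led Jp sp.
pose S := ideal_span (fun y => y \in G).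
have [S0 SD SM] : is_ideal S by apply: ideal_span_ideal.
have [s sG pE] := Ge _ Jp sp.
have [q [Sq sq qE]] : exists q, [/\ S q, (size q <= e.+1)%N &
    q`_e = \sum_(c <- s) c.1 * c.2].
  elim: s sG {pE} => [|[a c] s IHs] sG.
    by exists 0; rewrite big_nil coef0 size_poly0.
  have [|q [Sq sq qE]] := IHs; first by move=> y ys; apply: sG; rewrite inE ys orbT.
  have [/= r rG ->] := sG _ (mem_head _ _).
  exists ((a *: 'X^(e - d)) * r + q); rewrite big_cons coefD qE /=; split.
  - by apply: SD => //; apply: SM; apply: mem_ideal_span.
  - apply: leq_trans (size_polyD _ _) _; rewrite geq_max sq andbT.
    rewrite -scalerAl (leq_trans (size_scale_leq _ _)) //.
    rewrite (leq_trans (size_polyMleq _ _)) // size_polyXn.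
    by have := Gd r rG; lia.
  - by rewrite -scalerAl coefZ coefXnM ltnNge leq_subr /= subKn.
have JS x : S x -> J x by apply: ideal_span_min idJ GJ.
exists q; split=> //; first by apply: is_idealB => //; apply: JS.
apply/leq_sizeP => i; rewrite leq_eqVlt => /predU1P[<-|ltei].
  by rewrite coefB qE pE subrr.
by rewrite coefB !nth_default ?subrr // (leq_trans _ ltei).
Qed.

Lemma hilbert_basis_ideal : exists s : seq {poly B},
  (forall y, y \in s -> J y) /\ forall x, J x -> ideal_span (fun y => y \in s) x.
Proof.
have [G0 [D G0P]] := spans_above; have [G GP] := choice spans_level.
pose s := G0 ++ flatten [seq G d | d <- iota 0 D].
have sG d q : (d < D)%N -> q \in G d -> q \in s.
  move=> ltd qG; rewrite mem_cat; apply/orP; right; apply/flattenP.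
  by exists (G d) => //; apply: map_f; rewrite mem_iota.
have sJ y : y \in s -> J y.
  rewrite mem_cat => /orP[yG|/flattenP[_ /mapP[d _ ->] yG]].
    by case: (G0P D (leqnn D)) => GJ _ _; apply: GJ.
  by case: (GP d) => GJ _ _; apply: GJ.
exists s; split; first by [].
have [S0 SD SM] := ideal_span_ideal (fun y => y \in s).
move=> x; have [m] : exists m, (size x <= m)%N by exists (size x).
elim: m x => [|e IHe] x.
  by rewrite leqn0 size_poly_eq0 => /eqP ->.
move=> sx Jx; have [leDe|lteD] := leqP D e.
  have [q [Sq Jq sq]] := poly_reduce (G0P _ leDe) leDe Jx sx.
  rewrite -(subrK q x); apply: SD; first exact: IHe.
  by apply: ideal_span_mono Sq => y yG; rewrite mem_cat yG.
have [q [Sq Jq sq]] := poly_reduce (GP e) (leqnn e) Jx sx.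
rewrite -(subrK q x); apply: SD; first exact: IHe.
by apply: ideal_span_mono Sq => y yG; apply: sG yG.
Qed.

End HilbertBasis.

(** R is generated as a ring by the image of B and zs. Stated as an induction
    principle, it lets B grow to B[X] while a generator is removed from zs, which
    is how the two inductions on the number of generators below proceed. *)
Definition generated_by (B R : nzRingType) (phi : B -> R) (zs : seq R) : Prop :=
  forall C : R -> Prop, (forall b, C (phi b)) -> (forall z, z \in zs -> C z) ->
  (forall x y, C x -> C y -> C (x + y)) ->
  (forall x y, C x -> C y -> C (x * y)) -> forall u, C u.

Lemma generated_horner (B R : comNzRingType) (phi : {rmorphism B -> R})
    (z : R) (zs : seq R) (com : commr_rmorph phi z) :
  generated_by phi (z :: zs) -> generated_by (horner_morph com) zs.
Proof.
move=> gen C C0 Cz CD CM; apply: gen => // [b|y].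
  by have := C0 b%:P; rewrite /= horner_morphC.
rewrite inE => /predU1P[->|/Cz //].
by have := C0 'X; rewrite /= horner_morphX.
Qed.

(** Induction on zs, absorbing the first generator into the base ring B, which
    becomes B[X]. *)
Lemma fg_ideals_generated (B R : comNzRingType) (phi : {rmorphism B -> R})
    (zs : seq R) :
  fg_ideals B -> generated_by phi zs -> fg_ideals R.
Proof.
elim: zs B phi => [|z zs IHzs] B phi fgB gen.
  have phi_surj : forall u, exists b, u = phi b.
    apply: gen => //; first by move=> b; exists b.
      by move=> _ _ [a ->] [b ->]; exists (a + b); rewrite rmorphD.
    by move=> _ _ [a ->] [b ->]; exists (a * b); rewrite rmorphM.
  move=> J [J0 JD JM].
  have [|s [sJ Js]] := fgB (fun b => J (phi b)).
    split; first by rewrite rmorph0.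
      by move=> x y Jx Jy; rewrite rmorphD; apply: JD.
    by move=> a x Jx; rewrite rmorphM; apply: JM.
  exists (map phi s); split; first by move=> _ /mapP[b /sJ Jb ->].
  move=> u; have [b ->] := phi_surj u => /Js[t ts ->].
  exists [seq (phi c.1, phi c.2) | c <- t].
    by move=> _ /mapP[c /ts cs ->]; apply: map_f.
  by rewrite big_map rmorph_sum; apply: eq_bigr => c _; rewrite rmorphM.
have com : commr_rmorph phi z by move=> b; apply: mulrC.
apply: (IHzs _ (horner_morph com)); last exact: generated_horner.
by move=> J; apply: hilbert_basis_ideal.
Qed.

Lemma fg_ideals_field (k : fieldType) : fg_ideals k.
Proof.
move=> J [J0 JD JM]; have [[x Jx nz]|no] := EM (exists2 x, J x & x != 0).
  exists [:: x]; split=> [y|y Jy]; first by rewrite inE => /eqP ->.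
  exists [:: (y / x, x)]; last by rewrite big_seq1 divfK.
  by move=> p; rewrite !inE => /eqP ->.
exists [::]; split=> // x Jx; exists [::]; rewrite ?big_nil //.
by apply/eqP; apply: contra_notT no => nz; exists x.
Qed.

(** * Zariski's lemma *)

Lemma horner_map_sum (B K : comNzRingType) (phi : {rmorphism B -> K})
    (p : {poly B}) (w : K) n : (size p <= n)%N ->
  (map_poly phi p).[w] = \sum_(i < n) phi p`_i * w ^+ i.
Proof.
move=> sp; rewrite (@horner_coef_wide _ n) ?(leq_trans (size_poly _ _)) //.
by apply: eq_bigr => i _; rewrite coef_map.
Qed.

(** If c is the leading coefficient of p, of degree d, multiplying p (w) = 0 by
    c^(d-1) gives a monic equation for c w. *)
Lemma integral_lead_mul (B K : comNzRingType) (phi : {rmorphism B -> K})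
    (p : {poly B}) (w : K) :
  (1 < size p)%N -> root (map_poly phi p) w ->
  integralOver phi (phi (lead_coef p) * w).
Proof.
move=> sp /rootP pw; pose d := (size p).-1.
have sE : size p = d.+1 by rewrite /d prednK // (ltn_trans _ sp).
pose c := lead_coef p.
pose q := \poly_(i < d.+1) (if i == d then 1 else p`_i * c ^+ (d.-1 - i)).
have sq : size q = d.+1 by rewrite size_poly_eq // eqxx oner_eq0.
exists q.
  by apply/monicP; rewrite lead_coefE sq coef_poly ltnSn eqxx.
apply/rootP; rewrite -[RHS](mulr0 (phi c ^+ d.-1)) -pw.
rewrite !(@horner_map_sum _ _ _ _ _ d.+1) ?sq ?sE // mulr_sumr.
apply: eq_bigr => i _.
rewrite coef_poly ltn_ord; case: eqP => [->|/eqP ned].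
  rewrite rmorph1 mul1r exprMn mulrA; congr (_ * _).
  rewrite -[p`_d]/(lead_coef p) -/c -exprSr prednK //.
  by move: sp; rewrite sE ltnS.
have ltid : (i < d)%N by rewrite ltn_neqAle ned -ltnS ltn_ord.
rewrite rmorphM rmorphXn exprMn -/c.
have -> : phi c ^+ d.-1 = phi c ^+ (d.-1 - i) * phi c ^+ i.
  by rewrite -exprD subnK // -ltnS prednK // (leq_ltn_trans _ ltid).
by rewrite /=; ring.
Qed.

(** With v the inverse of g, clearing the powers of v in a monic equation of
    degree m for a v writes a^m as a multiple of g. *)
Lemma integral_inverse_dvd (B K : comNzRingType) (phi : {rmorphism B -> K})
    (a g : B) (v : K) :
  injective phi -> phi g * v = 1 -> integralOver phi (phi a * v) ->
  exists m h, a ^+ m = g * h.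
Proof.
move=> phi_inj gv [q qm /rootP qv]; pose D := (size q).-1.
have sE : size q = D.+1.
  by rewrite /D prednK // lt0n size_poly_eq0 monic_neq0.
suff qE : \sum_(i < D.+1) q`_i * a ^+ i * g ^+ (D - i) = 0.
  exists D, (- \sum_(i < D) q`_i * a ^+ i * g ^+ (D - i).-1).
  move: qE; rewrite big_ord_recr /= subnn mulr1 -[q`_D]/(lead_coef q).
  rewrite (monicP qm) mul1r => /eqP; rewrite addrC addr_eq0 => /eqP ->.
  rewrite mulrN mulr_sumr; congr (- _); apply: eq_bigr => i _.
  rewrite -[in LHS](@prednK (D - i)) ?subn_gt0 // exprS; ring.
apply: phi_inj; rewrite rmorph0 rmorph_sum /=.
transitivity (phi g ^+ D * (map_poly phi q).[phi a * v]); last first.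
  by rewrite qv mulr0.
rewrite (@horner_map_sum _ _ _ _ _ D.+1) ?sE // mulr_sumr.
apply: eq_bigr => i _; rewrite !rmorphM !rmorphXn exprMn /=.
have -> : phi g ^+ D = phi g ^+ (D - i) * phi g ^+ i.
  by rewrite -exprD subnK // -ltnS.
transitivity (phi q`_i * phi a ^+ i * phi g ^+ (D - i) * (phi g * v) ^+ i).
  by rewrite gv expr1n mulr1.
by rewrite exprMn; ring.
Qed.

Lemma common_denominator (B : idomainType) (K : comNzRingType)
    (phi : {rmorphism B -> K}) (ws : seq K) :
  injective phi ->
  (forall w, w \in ws -> exists2 p : {poly B}, p != 0 & root (map_poly phi p) w) ->
  exists2 f, f != 0 & forall w, w \in ws -> integralOver phi (phi f * w).
Proof.
move=> phi_inj; elim: ws => [|w ws IHws] alg.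
  by exists 1; rewrite ?oner_eq0.
have [|f nzf fP] := IHws; first by move=> y ys; apply: alg; rewrite inE ys orbT.
have [p nzp pw] := alg w (mem_head _ _).
have sp : (1 < size p)%N.
  rewrite ltnNge; apply: contra nzp => /size1_polyC pE; move: pw.
  rewrite pE map_polyC /root hornerC /= -(rmorph0 phi) => /eqP/phi_inj ->.
  by rewrite eqxx.
have cw := integral_lead_mul sp pw.
exists (lead_coef p * f); first by rewrite mulf_neq0 ?lead_coef_eq0.
move=> y; rewrite inE => /predU1P[->|/fP fy].
  by rewrite rmorphM mulrAC; apply: integral_mul => //; apply: integral_id.
by rewrite rmorphM -mulrA; apply: integral_mul => //; apply: integral_id.
Qed.

Lemma size_1DXM (B : idomainType) (f : {poly B}) :
  f != 0 -> (1 < size (1 + 'X * f)%R)%N.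
Proof.
move=> nzf; have sXf : size ('X * f) = (size f).+1 by rewrite mulrC size_mulX.
by rewrite addrC size_polyDl sXf ltnS ?size_poly1 size_poly_gt0.
Qed.

(** Modulo 1 + X f, the element f is invertible, with inverse - X; so if 1 + X f
    divided a power of f it would be a unit, which its degree forbids. *)
Lemma exp_neq_mul_1DXM (B : idomainType) (f h : {poly B}) (m : nat) :
  f != 0 -> f ^+ m <> (1 + 'X * f) * h.
Proof.
move=> nzf fE; set g := 1 + 'X * f in fE.
have sg : (1 < size g)%N by apply: size_1DXM.
have [h' h'E] : exists h', ('X * f) ^+ m - (-1) ^+ m = g * h'.
  exists (\sum_(i < m) ('X * f) ^+ (m.-1 - i) * (-1) ^+ i).
  by rewrite subrXX /g; congr (_ * _); rewrite opprK addrC.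
have gE : g * ((-1) ^+ m * ('X ^+ m * h - h')) = 1.
  transitivity ((-1) ^+ m * ('X ^+ m * (g * h) - g * h')); first by ring.
  rewrite -fE -h'E exprMn.
  transitivity (((-1) * (-1)) ^+ m : {poly B}); last by rewrite mulrNN mulr1 expr1n.
  by rewrite exprMn; ring.
set u := _ * (_ - _) in gE.
have nzu : u != 0 by apply: contra_eqN gE => /eqP ->; rewrite mulr0 eq_sym oner_eq0.
have := congr1 (fun p : {poly B} => size p) gE.
rewrite /= size_mul // ?size_poly1; last by rewrite -size_poly_gt0 ltnW.
move: nzu; rewrite -size_poly_gt0 => su sgu.
by move: su sg sgu; case: (size u) (size g) => [|a] [|[|b]] // _ _; rewrite addnS.
Qed.

(** Here K is a field, generated over B by zs and by the elements ws, algebraic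
    over B; the conclusion says that K is integral over B[1/f]. By induction on
    zs, an algebraic generator is moved to ws. A transcendental one, taken as the
    variable of B[X], is impossible: K would be integral over B[X][1/f] for some
    nonzero f in B[X], and integrality of the inverse of 1 + X f would make
    1 + X f divide a power of f. *)
Lemma zariski_fraction (K : comNzRingType) (zs : seq K) (B : idomainType)
    (phi : {rmorphism B -> K}) (ws : seq K) :
  injective phi -> (forall u : K, u != 0 -> exists v, u * v = 1) ->
  (forall w, w \in ws -> exists2 p : {poly B}, p != 0 & root (map_poly phi p) w) ->
  generated_by phi (zs ++ ws) ->
  exists2 f, f != 0 & forall u, exists e, integralOver phi (phi f ^+ e * u).
Proof.
move=> + inv; elim: zs B phi ws => [|z zs IHzs] B phi ws phi_inj alg gen.
  have [f nzf fP] := common_denominator phi_inj alg.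
  exists f => //; apply: gen.
  - by move=> b; exists 0; rewrite expr0 mul1r; apply: integral_id.
  - by move=> w /fP fw; exists 1; rewrite expr1.
  - move=> x y [d Dx] [e Ey]; exists (d + e)%N; rewrite mulrDr exprD.
    apply: integral_add; last rewrite mulrAC mulrC.
      rewrite mulrAC mulrC.
      by apply: integral_mul => //; rewrite -rmorphXn; apply: integral_id.
    rewrite mulrCA; apply: integral_mul; first by rewrite -rmorphXn; apply: integral_id.
    by [].
  - move=> x y [d Dx] [e Ey]; exists (d + e)%N; rewrite exprD mulrACA.
    exact: integral_mul.
have [zalg|ztrans] :=
    EM (exists2 p : {poly B}, p != 0 & root (map_poly phi p) z).
  apply: (IHzs _ _ (z :: ws)) => //.
    by move=> w; rewrite inE => /predU1P[->|/alg].
  move=> C C0 Cz; apply: gen => // y; rewrite inE mem_cat => yin.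
  by apply: Cz; rewrite mem_cat inE orbCA.
have com : commr_rmorph phi z by move=> b; apply: mulrC.
have hinj : injective (horner_morph com).
  apply: raddf_inj => p p0; apply/eqP; apply: contra_notT ztrans => nzp.
  by exists p => //; apply/rootP.
have [||f nzf fP] := IHzs _ (horner_morph com) ws hinj.
- move=> w /alg[p nzp pw]; exists (map_poly polyC p).
    by rewrite map_poly_eq0_id0 // polyC_eq0 lead_coef_eq0.
  rewrite -map_poly_comp (@eq_map_poly _ _ _ phi) //.
  by move=> b /=; rewrite horner_morphC.
- exact: generated_horner.
have nzg : 1 + 'X * f != 0 by rewrite -size_poly_gt0 (ltn_trans _ (size_1DXM nzf)).
have [|v gv] := inv (horner_morph com (1 + 'X * f)).
  by rewrite -(rmorph0 (horner_morph com)) (inj_eq hinj).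
have [e fev] := fP v; rewrite -rmorphXn in fev.
have [m [h fE]] := integral_inverse_dvd hinj gv fev.
by have [] := @exp_neq_mul_1DXM _ f h (e * m) nzf; rewrite exprM.
Qed.

Lemma zariski_field (k : fieldType) (K : comNzRingType)
    (phi : {rmorphism k -> K}) (zs : seq K) :
  (forall u : K, u != 0 -> exists v, u * v = 1) ->
  generated_by phi zs -> forall u, integralOver phi u.
Proof.
move=> inv gen u; have [|||f nzf fP] := @zariski_fraction K zs k phi [::] _ inv.
- exact: fmorph_inj.
- by [].
- by rewrite cats0.
have [e feu] := fP u.
have -> : u = phi (f ^- e) * (phi f ^+ e * u).
  rewrite mulrA -rmorphXn -rmorphM mulVf ?rmorph1 ?mul1r //.
  exact: expf_neq0.
by apply: integral_mul => //; apply: integral_id.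
Qed.

Lemma maximal_quot_inv (R : comNzRingType) (M : idealr R) :
  maximal_ideal M ->
  forall u : {ideal_quot M}, u != 0 -> exists v, u * v = 1.
Proof.
move=> maxM; elim/quotW => x nzx.
have nMx : x \notin M.
  apply: contra nzx => Mx; rewrite -(rmorph0 \pi_({ideal_quot M})).
  by rewrite -Quotient.idealrBE subr0.
have idN := is_ideal_adjoin x (idealr_is_ideal M).
have [[m [a [Mm E]]]|N1] := EM (exists m a, m \in M /\ 1 = m + a * x).
  exists (\pi a); rewrite -rmorphM -(rmorph1 \pi_({ideal_quot M})) /=.
  apply/eqP; rewrite -Quotient.idealrBE E.
  by rewrite opprD mulrC addrA addrAC subrr sub0r rpredN.
have [I IP] := is_ideal_idealr idN N1.
have sMI : {subset M <= I}.
  by move=> y My; apply/IP; exists y, 0; rewrite mul0r addr0.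
case/negP: nMx; rewrite (maxM I sMI); apply/IP.
by exists 0, 1; rewrite idealr0 mul1r add0r.
Qed.

(** By Zariski's lemma the residue field R/M is algebraic over k. *)
Lemma maximal_ideal_monic (k : fieldType) (R : comNzRingType)
    (phi : {rmorphism k -> R}) (zs : seq R) (M : idealr R) :
  generated_by phi zs -> maximal_ideal M ->
  forall y, exists2 f : {poly k}, f \is monic & (map_poly phi f).[y] \in M.
Proof.
move=> gen maxM y; pose pM := \pi_({ideal_quot M}) : {rmorphism R -> _}.
have genM : generated_by (pM \o phi) (map pM zs).
  move=> C C0 Cz CD CM; elim/quotW; apply: gen => //.
  - by move=> z zin; apply: Cz; apply: (map_f pM zin).
  - by move=> a b Ca Cb; have := CD _ _ Ca Cb; rewrite -rmorphD.
  - by move=> a b Ca Cb; have := CM _ _ Ca Cb; rewrite -rmorphM.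
have [f fm /rootP fy] := zariski_field (maximal_quot_inv maxM) genM (pM y).
exists f => //; rewrite -[X in X \in _]subr0 Quotient.idealrBE; apply/eqP.
by move: fy; rewrite map_poly_comp horner_map => fy; rewrite [LHS]fy rmorph0.
Qed.

(** * Localization at a prime *)

(** Regular sequences without the condition that they span a proper ideal. *)
Definition weakly_regular (S : comNzRingType) (s : seq S) : Prop :=
  forall i x, (i < size s)%N ->
    ideal_span (fun y => y \in take i s) (s`_i * x) ->
    ideal_span (fun y => y \in take i s) x.

Section LocalizationTheory.
Variables (R : comNzRingType) (P : prime_idealr R).
Notation L := (localization P).
Notation loc := (@Localization.tolocal R P).

Lemma tolocal_zmod_morphism : zmod_morphism loc.
Proof.
by move=> x y; rewrite !piE; apply: Localization.pi_eq => /=; ring.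
Qed.

Lemma tolocal_monoid_morphism : monoid_morphism loc.
Proof.
by split=> // x y; rewrite !piE; apply: Localization.pi_eq => /=; ring.
Qed.

HB.instance Definition _ :=
  GRing.isZmodMorphism.Build R L loc tolocal_zmod_morphism.
HB.instance Definition _ :=
  GRing.isMonoidMorphism.Build R L loc tolocal_monoid_morphism.

Lemma tolocal_unit s : s \notin P -> exists v, loc s * v = 1.
Proof.
move=> Ps; exists (\pi_L (Localization.num_den 1 Ps)).
by rewrite !piE; apply: Localization.pi_eq => /=; ring.
Qed.

Lemma tolocal_frac (x : L) : exists s a, s \notin P /\ x * loc s = loc a.
Proof.
elim/quotW: x => x; exists x.2, x.1; split; first exact: Localization.fracP.
by rewrite !piE; apply: Localization.pi_eq => /=; ring.
Qed.

Lemma tolocal_eq0 a : loc a = 0 -> exists2 s, s \notin P & s * a = 0.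
Proof.
have -> : 0 = loc 0 by rewrite rmorph0.
rewrite !piE => /eqP/Localization.piP[s Ps sa]; exists s => //.
by rewrite -[RHS]sa /=; ring.
Qed.

Definition loc_extension (J : R -> Prop) (x : L) : Prop :=
  exists s a, [/\ s \notin P, J a & x * loc s = loc a].

Lemma loc_extension_ideal J : is_ideal J -> is_ideal (loc_extension J).
Proof.
move=> [J0 JD JM]; split.
- by exists 1, 0; rewrite idealr1 mul0r rmorph0.
- move=> x y [s [a [Ps Ja xE]]] [t [b [Pt Jb yE]]].
  exists (s * t), (t * a + s * b); split.
  + exact: Localization.notin_primeM.
  + by apply: (JD); apply: JM.
  + by rewrite rmorphD !rmorphM /= -xE -yE; ring.
- move=> z x [s [a [Ps Ja xE]]]; have [t [b [Pt zE]]] := tolocal_frac z.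
  exists (t * s), (b * a); split; [exact: Localization.notin_primeM|exact: JM|].
  by rewrite !rmorphM /= -xE -zE; ring.
Qed.

Lemma loc_extension_tolocal J a : is_ideal J ->
  loc_extension J (loc a) -> exists2 s, s \notin P & J (s * a).
Proof.
move=> [J0 JD JM] [s [b [Ps Jb /eqP]]]; rewrite -rmorphM -subr_eq0 -rmorphB.
move=> /eqP/tolocal_eq0[t Pt]; rewrite mulrBr => /eqP; rewrite subr_eq0 => /eqP E.
exists (t * s); first exact: Localization.notin_primeM.
by rewrite -mulrA [s * a]mulrC E; apply: JM.
Qed.

Let mem_loc_max := loc_extension (fun a => a \in P).

Local Lemma mem_loc_max_tolocal a : mem_loc_max (loc a) -> a \in P.
Proof.
move=> /(loc_extension_tolocal (idealr_is_ideal P))[s Ps].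
by rewrite prime_idealrM (negbTE Ps).
Qed.

Lemma loc_maximal_exists : exists M : prime_idealr L,
  local_ring M /\ forall a, a \in P -> loc a \in M.
Proof.
have idM := loc_extension_ideal (idealr_is_ideal P).
have [|x y|M MP] := is_ideal_prime_idealr idM.
- by rewrite -(rmorph1 loc) => /mem_loc_max_tolocal; rewrite idealr1.
- have [s [a [Ps xE]]] := tolocal_frac x; have [t [b [Pt yE]]] := tolocal_frac y.
  move=> Mxy; have : mem_loc_max (loc (a * b)).
    case: idM => _ _ IM; rewrite rmorphM /= -xE -yE.
    have -> : x * loc s * (y * loc t) = (loc s * loc t) * (x * y) by ring.
    exact: IM.
  move=> /mem_loc_max_tolocal; rewrite prime_idealrM => /orP[aP|bP].
    by left; exists s, a.
  by right; exists t, b.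
have sub (J : idealr L) : {subset J <= M}.
  move=> x Jx; apply/MP; have [s [a [Ps xE]]] := tolocal_frac x.
  exists s, a; split=> //; apply/negPn/negP => /tolocal_unit[v av].
  suff : 1 \in J by rewrite idealr1.
  by rewrite -av -xE -mulrA mulrC idealMr.
exists M; split; last first.
  by move=> a Pa; apply/MP; exists 1, a; rewrite idealr1 rmorph1 mulr1.
split=> [J sMJ x|J maxJ x].
  by apply/idP/idP => [/sMJ|/sub].
exact: maxJ (sub J) x.
Qed.

Lemma ideal_span_tolocal (t : seq R) x :
  ideal_span (fun y => y \in map loc t) x ->
  loc_extension (ideal_span (fun y => y \in t)) x.
Proof.
apply: ideal_span_min; first exact/loc_extension_ideal/ideal_span_ideal.
move=> _ /mapP[y yt ->]; exists 1, y; split; rewrite ?idealr1 ?rmorph1 ?mulr1 //.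
exact: mem_ideal_span.
Qed.

Lemma tolocal_ideal_span (t : seq R) a :
  ideal_span (fun y => y \in t) a ->
  ideal_span (fun y => y \in map loc t) (loc a).
Proof.
move=> [r rt ->]; exists [seq (loc p.1, loc p.2) | p <- r].
  by move=> _ /mapP[p /rt pt ->]; apply: map_f.
by rewrite big_map rmorph_sum; apply: eq_bigr => p _; rewrite rmorphM.
Qed.

(** Flatness of localization: a relation over R_P becomes a relation over R after
    multiplication by an element outside P. *)
Lemma weakly_regular_tolocal (s : seq R) :
  weakly_regular s -> weakly_regular (map loc s).
Proof.
move=> reg i x; rewrite size_map => lti; rewrite -map_take (nth_map 0) //.
set t := take i s => /ideal_span_tolocal sx.
have idt := ideal_span_ideal (fun y => y \in t).
have [v [a [Pv xE]]] := tolocal_frac x.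
have [u Pu] : exists2 u, u \notin P & ideal_span (fun y => y \in t) (u * (s`_i * a)).
  apply: loc_extension_tolocal => //.
  rewrite rmorphM /= -xE mulrA mulrC.
  by case: (loc_extension_ideal idt) => _ _; apply.
rewrite mulrCA => /(reg _ _ lti)/tolocal_ideal_span; rewrite rmorphM /= -xE.
have [w] : exists w, loc (u * v) * w = 1.
  exact/tolocal_unit/Localization.notin_primeM.
rewrite rmorphM => uvw span.
have -> : x = w * (loc u * (x * loc v)).
  by rewrite -[LHS]mulr1 -uvw; ring.
by case: (ideal_span_ideal (fun y => y \in map loc t)) => _ _; apply.
Qed.

(** Every regular sequence of R_P in the maximal ideal yields a prime chain of the
    same length. So if the length of s bounds those of the prime chains, it is
    both the depth and the dimension. *)
Lemma weakly_regular_localization_cohen_macaulay (s : seq R) :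
  weakly_regular s -> {subset s <= P} ->
  (forall d (c : 'I_d.+1 -> prime_idealr L), prime_chain c -> (d <= size s)%N) ->
  cohen_macaulay_local L.
Proof.
move=> reg sP bound; have [M [locM PM]] := loc_maximal_exists.
have regL : regular_sequence (map loc s).
  split; first exact: weakly_regular_tolocal.
  move=> /(ideal_span_min (idealr_is_ideal M)) M1.
  suff : 1 \in M by rewrite idealr1.
  by apply: M1 => _ /mapP[y /sP Py ->]; apply: PM.
have sM : {subset map loc s <= M} by move=> _ /mapP[y /sP Py ->]; apply: PM.
exists M, (size s); split=> //.
  split; first by exists (map loc s); rewrite size_map.
  by move=> t regt /(regular_sequence_prime_chain regt)[c /bound].
split; last exact: bound.
by have := regular_sequence_prime_chain regL sM; rewrite size_map.
Qed.

End LocalizationTheory.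

(** * Bounding the lengths of prime chains *)

Section ChainBound.
Variables (k : fieldType) (L : comNzRingType) (phi : {rmorphism k -> L}).

(** If y_i is in c_{i+1} but not in c_i, then y_0, ..., y_{n-1} are algebraically
    independent. In a relation, select the monomials of least exponent in y_0,
    among these the ones of least exponent in y_1, and so on. At each step, as
    y_i is outside c_i, the minimal power of y_i can be divided out of a sum lying
    in c_i, and modulo c_{i+1} only the terms with this minimal exponent
    survive. At the end a single nonzero constant would lie in c_n. *)
Lemma prime_chain_independent (n N : nat) (c : nat -> prime_idealr L)
    (y : 'I_n -> L) (q : {ffun 'I_n -> 'I_N} -> k) :
  (forall i : 'I_n, [/\ {subset c i <= c i.+1}, y i \in c i.+1 & y i \notin c i]) ->
  \sum_f phi (q f) * \prod_j y j ^+ f j = 0 -> forall f, q f = 0.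
Proof.
move=> cP q0 f0; apply/eqP; apply/negPn/negP => nzf0.
pose part i (f : {ffun 'I_n -> 'I_N}) := \prod_(j < n | (i <= j)%N) y j ^+ f j.
suff chain i : (i <= n)%N -> exists T : {set {ffun 'I_n -> 'I_N}},
    [/\ exists f, f \in T, forall f, f \in T -> q f != 0,
        forall f g, f \in T -> g \in T -> forall j : 'I_n, (j < i)%N -> f j = g j &
        \sum_(f in T) phi (q f) * part i f \in c i].
  have [T [[f fT] Tq Tu]] := chain n (leqnn n).
  have -> : T = [set f].
    apply/setP => g; rewrite inE; apply/idP/eqP => [gT|-> //].
    by apply/ffunP => j; apply: Tu => //; apply: ltn_ord.
  rewrite big_set1 /part big_pred0; last by move=> j; rewrite leqNgt ltn_ord.
  rewrite mulr1 => cf; suff : 1 \in c n by rewrite idealr1.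
  rewrite -(rmorph1 phi) -(mulVf (Tq _ fT)) rmorphM; exact: idealMr.
elim: i => [_|i IHi ltin].
  exists [set f | q f != 0]; split=> //.
  - by exists f0; rewrite inE.
  - by move=> f; rewrite inE.
  suff -> : \sum_(f in [set f | q f != 0]) phi (q f) * part 0 f = 0 by apply: idealr0.
  rewrite -[RHS]q0 big_mkcond; apply: eq_bigr => f _; rewrite inE.
  by case: eqP => [->|//]; rewrite rmorph0 mul0r.
have [T [[f1 f1T] Tq Tu Tc]] := IHi (ltnW ltin).
pose o := Ordinal ltin; have [sub yin ynin] := cP o; rewrite /= in sub yin ynin.
pose f2 := [arg min_(f < f1 in T) (f o : nat)].
have [f2T f2min] : f2 \in T /\ forall f, f \in T -> (f2 o <= f o)%N.
  by rewrite /f2; case: arg_minnP.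
have partE f : part i f = y o ^+ f o * part i.+1 f.
  rewrite /part (bigD1 o) //=; congr (_ * _); apply: eq_bigl => j.
  by rewrite ltn_neqAle andbC eq_sym.
exists [set f in T | f o == f2 o]; split.
- by exists f2; rewrite inE f2T eqxx.
- by move=> f; rewrite inE => /andP[/Tq].
- move=> f g; rewrite !inE => /andP[fT /eqP fo] /andP[gT /eqP go] j.
  rewrite ltnS leq_eqVlt => /predU1P[jo|ltji]; last exact: Tu.
  have -> : j = o by apply: val_inj.
  by rewrite fo go.
have : \sum_(f in T) phi (q f) * (y o ^+ (f o - f2 o) * part i.+1 f) \in c i.
  move: Tc; rewrite (_ : \sum_(f in T) _ =
    y o ^+ f2 o * \sum_(f in T) phi (q f) * (y o ^+ (f o - f2 o) * part i.+1 f)).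
    rewrite prime_idealrM => /orP[|//].
    suff ny m : y o ^+ m \notin c i by rewrite (negbTE (ny _)).
    elim: m => [|m IHm]; first by rewrite expr0 idealr1.
    by rewrite exprS prime_idealrM negb_or ynin.
  rewrite mulr_sumr; apply: eq_bigr => f fT; rewrite partE.
  have -> : y o ^+ f o = y o ^+ (f o - f2 o) * y o ^+ f2 o.
    by rewrite -exprD subnK // f2min.
  move: (y o ^+ (f o - f2 o)) (y o ^+ f2 o) (part i.+1 f) (phi (q f)) => a b c' u.
  by ring.
move=> /sub; rewrite (bigID (fun f : {ffun 'I_n -> 'I_N} => f o == f2 o)) /=.
rewrite [X in X + _ \in _](_ : _ =
  \sum_(f in [set f in T | f o == f2 o]) phi (q f) * part i.+1 f); last first.
  apply: eq_big => [f|f /andP[_ /eqP ->]]; first by rewrite inE.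
  by rewrite subnn expr0 mul1r.
rewrite rpredDr //; apply: rpred_sum => f /andP[fT nef].
have : (0 < f o - f2 o)%N.
  by rewrite subn_gt0 ltn_neqAle f2min // andbT eq_sym.
case: (f o - f2 o)%N => // m _; rewrite exprS.
have -> : phi (q f) * (y o * y o ^+ m * part i.+1 f) =
    (phi (q f) * y o ^+ m * part i.+1 f) * y o.
  by move: (y o ^+ m) (part i.+1 f) (phi (q f)) => a b u; ring.
exact: idealMr.
Qed.

End ChainBound.

(** * Monic polynomials in distinct variables *)

Lemma mpoly_generated (k : comNzRingType) (n : nat) (C : {mpoly k[n]} -> Prop) :
  (forall c, C c%:MP) -> (forall i : 'I_n, C 'X_i) ->
  (forall p q, C p -> C q -> C (p + q)) ->
  (forall p q, C p -> C q -> C (p * q)) -> forall p, C p.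
Proof.
move=> CC CX CD CM; elim/mpolyind => [|c m p _ _ Cp]; first by rewrite -mpolyC0.
apply: (CD) => //; rewrite -mul_mpolyC; apply: (CM) => //.
rewrite mpolyXE_id; elim/big_rec: _ => [|i q _ Cq]; first by rewrite -mpolyC1.
apply: (CM) => //; elim: (m i) => [|e IHe]; first by rewrite expr0 -mpolyC1.
by rewrite exprS; apply: CM.
Qed.

(** A polynomial is viewed as one in t_i, with coefficients that do not involve
    t_i but are kept in the full ring. *)
Lemma mpoly_split_var (k : comNzRingType) (n : nat) (i : 'I_n) :
  exists psi : {rmorphism {mpoly k[n]} -> {poly {mpoly k[n]}}},
    (forall c, psi c%:MP = c%:MP%:P) /\
    (forall j, psi 'X_j = if j == i then 'X else ('X_j)%:P).
Proof.
pose h j : {poly {mpoly k[n]}} := if j == i then 'X else ('X_j)%:P.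
exists (mmap (polyC \o @mpolyC n k) h); split=> [c|j].
  by rewrite /= mmapC.
by rewrite /= mmapX mmap1U.
Qed.

Section MonicInVariables.
Variables (k : fieldType) (n : nat) (f : 'I_n -> {poly k}).
Hypothesis f_monic : forall i, f i \is monic.
Notation A := {mpoly k[n]}.
Implicit Types (p q : A) (i j : 'I_n) (t : seq 'I_n).

Definition at_var i : A := (map_poly (@mpolyC n k) (f i)).['X_i].

(** The remainder modulo f_i (t_i), which is monic in t_i: it is linear over
    polynomials in the other variables. *)
Lemma at_var_remainder i : at_var i != 0 /\ exists rem : A -> A,
  [/\ {morph rem : p q / p + q}, forall p, rem (at_var i * p) = 0,
      forall j p, j != i -> rem (at_var j * p) = at_var j * rem p &
      forall p, exists q, p - rem p = at_var i * q].
Proof.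
have [psi [psiC psiX]] := mpoly_split_var k i.
pose fA j : {poly A} := map_poly (@mpolyC n k) (f j).
have fA_monic j : fA j \is monic by apply: monic_map.
have psiK p : (psi p).['X_i] = p.
  elim/mpoly_generated: p => [c|j|p q IHp IHq|p q IHp IHq].
  - by rewrite psiC hornerC.
  - by rewrite psiX; case: eqP => [->|_]; rewrite ?hornerX ?hornerC.
  - by rewrite rmorphD hornerD IHp IHq.
  - by rewrite rmorphM hornerM IHp IHq.
have psiE j : psi (at_var j) = (map_poly polyC (fA j)).[psi 'X_j].
  rewrite /at_var -horner_map -!map_poly_comp; congr (_.[_]).
  by apply: eq_map_poly => c /=; rewrite psiC.
have psi_i : psi (at_var i) = fA i.
  by rewrite psiE psiX eqxx -/(comp_poly 'X (fA i)) comp_polyXr.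
have psi_j j : j != i -> psi (at_var j) = (at_var j)%:P.
  by move=> neji; rewrite psiE psiX (negbTE neji) horner_map.
split.
  apply: contraTneq (fA_monic i) => a0; rewrite -psi_i a0 rmorph0.
  by rewrite monicE lead_coef0 eq_sym oner_eq0.
exists (fun p => (Pdiv.Ring.rmodp (psi p) (fA i)).['X_i]); split.
- by move=> p q; rewrite rmorphD Pdiv.RingMonic.rmodpD ?hornerD.
- move=> p; rewrite rmorphM psi_i mulrC Pdiv.RingMonic.rmodp_mull ?horner0 //.
- move=> j p neji; rewrite rmorphM psi_j // mul_polyC.
  by rewrite Pdiv.RingMonic.rmodpZ // hornerZ.
- move=> p; exists (Pdiv.Ring.rdivp (psi p) (fA i)).['X_i].
  rewrite -{1}(psiK p) {1}(Pdiv.RingMonic.rdivp_eq (fA_monic i) (psi p)).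
  by rewrite hornerD addrK hornerM mulrC.
Qed.

(** Composing the remainder maps for j in t gives a map [rems t] whose kernel is
    the ideal spanned by the f_j (t_j); since i is not in t, it commutes with
    multiplication by f_i (t_i), which is a nonzero element of a domain. *)
Lemma at_var_regular t i p : uniq t -> i \notin t ->
  ideal_span (fun y => y \in map at_var t) (at_var i * p) ->
  ideal_span (fun y => y \in map at_var t) p.
Proof.
have [rem remP] := choice (fun j => (at_var_remainder j).2).
pose rems s q := foldr rem q s.
have rem0 j : rem j 0 = 0.
  by have [remD _ _ _] := remP j; apply: (addrI (rem j 0)); rewrite -remD !addr0.
have remsD s : {morph rems s : q r / q + r}.
  by move=> q r; elim: s => //= j s ->; case: (remP j).
have rems0 s : rems s 0 = 0 by elim: s => //= j s ->.
have rems_notin s j q :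
    j \notin s -> rems s (at_var j * q) = at_var j * rems s q.
  elim: s => //= l s IHs; rewrite inE negb_or => /andP[nejl njs].
  by rewrite IHs //; case: (remP l) => _ _ + _; apply.
have rems_in s j q : uniq s -> j \in s -> rems s (at_var j * q) = 0.
  elim: s => //= l s IHs /andP[nls us]; rewrite inE => /predU1P[->|js].
    by rewrite rems_notin //; case: (remP l).
  by rewrite IHs.
have rems_mod s q : ideal_span (fun y => y \in map at_var s) (q - rems s q).
  elim: s => [|l s IHs] /=.
    by rewrite subrr; case: (ideal_span_ideal (fun y : A => y \in [::])).
  set J := ideal_span _; have [J0 JD JM] : is_ideal J by apply: ideal_span_ideal.
  have -> : q - rem l (rems s q) = (q - rems s q) + (rems s q - rem l (rems s q)).
    by rewrite addrA subrK.
  apply: (JD).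
    by apply: ideal_span_mono IHs => y ys; rewrite inE ys orbT.
  have [_ _ _ /(_ (rems s q))[r ->]] := remP l.
  by rewrite mulrC; apply: JM; apply: mem_ideal_span; rewrite mem_head.
move=> ut nit [s st E].
suff rp : rems t p = 0 by have := rems_mod t p; rewrite rp subr0.
apply: (mulfI (at_var_remainder i).1); rewrite mulr0 -rems_notin // E.
rewrite (big_morph (rems t) (remsD t) (rems0 t)) big_seq big1 // => c /st.
by move=> /mapP[j jt ->]; rewrite mulrC rems_in.
Qed.

End MonicInVariables.

(** * Algebraic dependence of n + 1 elements *)

Section AlgebraicDependence.
Variables (k : fieldType) (n : nat).
Notation A := {mpoly k[n]}.

Lemma msizeM_leq (p q : A) a b : (msize p <= a.+1)%N -> (msize q <= b.+1)%N ->
  (msize (p * q) <= (a + b).+1)%N.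
Proof.
have [->|nzp] := eqVneq p 0; first by rewrite mul0r mmeasure0.
have [->|nzq] := eqVneq q 0; first by rewrite mulr0 mmeasure0.
move=> pa qb; rewrite msizeM // -subn1 leq_subLR add1n -addSn -addnS.
exact: leq_add.
Qed.

Lemma msizeX_leq (p : A) d e : (msize p <= d.+1)%N -> (msize (p ^+ e) <= (e * d).+1)%N.
Proof.
move=> pd; elim: e => [|e IHe]; first by rewrite expr0 msize1.
by rewrite exprS mulSn; apply: msizeM_leq.
Qed.

Lemma msize_monomial_leq (m N d : nat) (y : 'I_m -> A) (e : 'I_m -> nat) :
  (forall j, (msize (y j) <= d.+1)%N) -> (forall j, (e j <= N)%N) ->
  (msize (\prod_j y j ^+ e j) <= (m * (N * d)).+1)%N.
Proof.
move=> yd eN; elim: m y e yd eN => [|m IHm] y e yd eN.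
  by rewrite big_ord0 msize1.
rewrite big_ord_recl mulSn; apply: msizeM_leq.
  by apply: leq_trans (msizeX_leq (e ord0) (yd _)) _; rewrite ltnS leq_mul2r eN orbT.
by apply: IHm.
Qed.

Lemma card_bmultinom_leq (D : nat) : (#|{: 'X_{1..n < D.+1}}| <= D.+1 ^ n)%N.
Proof.
pose g (m : 'X_{1..n < D.+1}) := [ffun i : 'I_n => inord (m i) : 'I_D.+1].
have g_inj : injective g.
  move=> m1 m2 /ffunP gE; apply/val_inj/mnmP => i.
  have lt (m : 'X_{1..n < D.+1}) : (m i < D.+1)%N.
    apply: leq_ltn_trans (bmdeg m); rewrite mdegE (bigD1 i) //=; exact: leq_addr.
  by move: (gE i); rewrite !ffunE => /(congr1 val); rewrite /= !inordK.
by rewrite (leq_trans (leq_card g g_inj)) // card_ffun !card_ord.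
Qed.

(** There are N^(n+1) monomials in the x_j with exponents below N, while their
    images by all the rho_b have degree O(N), hence lie in a space of dimension
    O(N^n) over k. For N large this forces a linear relation. *)
Lemma algebraic_dependence (B : finType) (R : comNzRingType)
    (ev : {rmorphism k -> R}) (rho : B -> {rmorphism R -> A}) (x : 'I_n.+1 -> R) :
  (forall b c, rho b (ev c) = c%:MP) ->
  (forall u, (forall b, rho b u = 0) -> u = 0) ->
  exists (N : nat) (q : {ffun 'I_n.+1 -> 'I_N} -> k),
    (exists f, q f != 0) /\ \sum_f ev (q f) * \prod_j x j ^+ f j = 0.
Proof.
move=> rho_ev rho_inj.
have [d dP] : exists d, forall b j, (msize (rho b (x j)) <= d.+1)%N.
  exists (\max_b \max_j msize (rho b (x j))) => b j; apply: leqW.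
  apply: leq_trans (leq_bigmax b).
  exact: (leq_bigmax (F := fun j => msize (rho b (x j)))).
(* D bounds the sizes of the images and D <= N K, so that #|B| K^n < N is what
   makes #|B| D^n < N^(n+1). *)
pose K := (n.+1 * d).+1; pose N := (#|B| * K ^ n).+1; pose D := (n.+1 * (N * d)).+1.
pose T1 : finType := {ffun 'I_n.+1 -> 'I_N}.
pose T2 : finType := (B * 'X_{1..n < D})%type.
have ltT : (#|{: T2}| < #|{: T1}|)%N.
  rewrite card_prod card_ffun !card_ord.
  apply: (@leq_ltn_trans (#|B| * (N * K) ^ n)).
    rewrite leq_mul2l (leq_trans (card_bmultinom_leq _)) ?orbT //.
    have leDK : (D <= N * K)%N by rewrite /D /K; nia.
    rewrite -/D; move: (D) (N * K)%N leDK => D' E.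
    by case: (n) => [|n'] DE; rewrite ?expn0 ?leq_exp2r.
  by rewrite expnMn mulnCA expnS mulnC ltn_pmul2r ?expn_gt0 // mulnC.
pose P (g : {ffun 'I_n.+1 -> 'I_N}) b : A := \prod_j rho b (x j) ^+ g j.
have Pd g b : (msize (P g b) <= D)%N.
  by apply: msize_monomial_leq => [j|j]; [apply: dP | apply: ltnW].
pose M : 'M[k]_(#|{: T1}|, #|{: T2}|) :=
  \matrix_(i, j) (let c := @enum_val T2 predT j in (P (@enum_val T1 predT i) c.1)@_c.2).
have /rowV0Pn[v /sub_kermxP vM nzv] : kermx M != 0.
  rewrite -mxrank_eq0 mxrank_ker subn_eq0 -ltnNge.
  exact: leq_ltn_trans (rank_leq_col M) ltT.
exists N, (fun g => v 0 (enum_rank g)); split.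
  have [i nzi] := rV0Pn _ nzv; exists (enum_val i).
  by rewrite enum_valK.
apply: rho_inj => b; apply/mpolyP => m; rewrite mcoeff0 rmorph_sum raddf_sum /=.
transitivity (\sum_(g : T1) v 0 (enum_rank g) * (P g b)@_m).
  apply: eq_bigr => g _; rewrite rmorphM rho_ev rmorph_prod mcoeffCM.
  by congr (_ * _@__); apply: eq_bigr => j _; rewrite rmorphXn.
have [ltm|lem] := ltnP (mdeg m) D; last first.
  rewrite big1 // => g _.
  by rewrite memN_msupp_eq0 ?mulr0 // msize_mdeg_ge // (leq_trans (Pd g b)).
pose c : T2 := (b, BMultinom ltm).
transitivity ((v *m M) 0 (enum_rank c)); last by rewrite vM mxE.
rewrite mxE (reindex (@enum_val T1 predT)) /=; last exact/onW_bij/enum_val_bij.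
by apply: eq_bigr => i _; rewrite mxE enum_valK enum_rankK.
Qed.

End AlgebraicDependence.

(** * Rings that are free over a polynomial ring *)

(** The ring R is an A-algebra through [ev], spanned as an A-module by the m_b,
    with retractions [rho b] onto A that are triangular on the m_b for the height
    h. So R is free, and moreover embeds in a power of A as a ring. *)
Section TriangularlyFree.
Variables (k : fieldType) (n : nat) (R : comNzRingType).
Notation A := {mpoly k[n]}.
Variables (ev : {rmorphism A -> R}) (B : finType) (m : B -> R).
Variables (rho : B -> {rmorphism R -> A}) (h : B -> nat).
Hypothesis rhoK : forall b p, rho b (ev p) = p.
Hypothesis rho_neq0 : forall b, rho b (m b) != 0.
Hypothesis rho_eq0 : forall b b', b' != b -> (h b <= h b')%N -> rho b (m b') = 0.
Hypothesis span : forall x, exists a : B -> A, x = \sum_b ev (a b) * m b.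

(** Induction on the height of b: applying [rho b] leaves only the term of b. *)
Lemma rho_separates (a : B -> A) :
  (forall b, rho b (\sum_b' ev (a b') * m b') = 0) -> forall b, a b = 0.
Proof.
move=> a0 b; have [d] := ubnP (h b); elim: d b => // d IHd b; rewrite ltnS => hb.
apply: (mulIf (rho_neq0 b)); rewrite mul0r -[RHS](a0 b) rmorph_sum (bigD1 b) //=.
rewrite rmorphM rhoK big1 ?addr0 // => b' neb; rewrite rmorphM rhoK.
have [lth|leh] := ltnP (h b') (h b); last by rewrite rho_eq0 ?mulr0.
by rewrite IHd ?mul0r // (leq_trans lth).
Qed.

Lemma rho_injective x : (forall b, rho b x = 0) -> x = 0.
Proof.
have [a ->] := span x => /rho_separates a0.
by rewrite big1 // => b _; rewrite a0 rmorph0 mul0r.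
Qed.

Lemma basis_unique (a a' : B -> A) :
  \sum_b ev (a b) * m b = \sum_b ev (a' b) * m b -> forall b, a b = a' b.
Proof.
move=> aa' b; apply/eqP; rewrite -subr_eq0; apply/eqP.
apply: (rho_separates (a := fun b => a b - a' b)) => b'.
rewrite (eq_bigr (fun b => ev (a b) * m b - ev (a' b) * m b)); last first.
  by move=> c _; rewrite rmorphB mulrBl.
by rewrite sumrB aa' subrr rmorph0.
Qed.

(** Multiplication by an element of R acts on coordinates through a matrix over A,
    so the elements whose coordinates lie in a given ideal of A form an ideal of
    R; uniqueness of the coordinates gives the direct implication. *)
Lemma ideal_coordinates (t : seq A) (a : B -> A) :
  ideal_span (fun y => y \in map ev t) (\sum_b ev (a b) * m b) <->
  forall b, ideal_span (fun y => y \in t) (a b).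
Proof.
set J := ideal_span (fun y => y \in t).
have [J0 JD JM] : is_ideal J by apply: ideal_span_ideal.
have JS (I : finType) (F : I -> A) : (forall i, J (F i)) -> J (\sum_i F i).
  by move=> JF; apply: is_ideal_sum => //; apply: ideal_span_ideal.
split=> [sp b|Ja].
  pose Q y := exists2 c : B -> A, y = \sum_b ev (c b) * m b & forall b, J (c b).
  suff [c /basis_unique -> //] : Q (\sum_b ev (a b) * m b).
  have [c cP] := choice span.
  apply: ideal_span_min sp.
    split.
    - by exists (fun=> 0) => //; rewrite big1 // => b' _; rewrite rmorph0 mul0r.
    - move=> _ _ [a1 -> J1] [a2 -> J2]; exists (fun b => a1 b + a2 b).
        by rewrite -big_split; apply: eq_bigr => b' _; rewrite rmorphD mulrDl.
      by move=> b'; apply: JD.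
    - move=> z _ [a1 -> J1].
      exists (fun b' => \sum_b'' c (z * m b'') b' * a1 b''); last first.
        by move=> b'; apply: JS => b''; apply: JM.
      rewrite mulr_sumr.
      transitivity (\sum_b'' \sum_b' ev (c (z * m b'') b' * a1 b'') * m b').
        apply: eq_bigr => b'' _; rewrite mulrCA {1}(cP (z * m b'')) mulr_sumr.
        by apply: eq_bigr => b' _; rewrite rmorphM mulrA [ev (a1 _) * _]mulrC.
      rewrite exchange_big; apply: eq_bigr => b' _.
      by rewrite rmorph_sum mulr_suml.
  move=> _ /mapP[y yt ->]; exists (fun b => c 1 b * y).
    rewrite -[LHS]mulr1 {1}(cP 1) mulr_sumr; apply: eq_bigr => b' _.
    by rewrite rmorphM mulrA [ev y * _]mulrC.
  by move=> b'; apply: JM; apply: mem_ideal_span.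
apply: is_ideal_sum; first exact: ideal_span_ideal.
move=> b _; have [s st ->] := Ja b.
rewrite rmorph_sum mulr_suml; apply: is_ideal_sum; first exact: ideal_span_ideal.
move=> c /st ct; rewrite rmorphM mulrAC.
case: (ideal_span_ideal (fun y => y \in map ev t)) => _ _; apply.
by apply: mem_ideal_span; apply: map_f.
Qed.

Lemma at_var_weakly_regular (f : 'I_n -> {poly k}) :
  (forall i, f i \is monic) ->
  weakly_regular [seq ev (at_var f i) | i <- enum 'I_n].
Proof.
move=> f_monic j x; rewrite size_map => ltj.
have i0 : 'I_n by rewrite size_enum_ord in ltj; apply: Ordinal ltj.
rewrite (nth_map i0) // -map_take; set t := take j _; set i := nth _ _ _.
have ut : uniq t by rewrite take_uniq ?enum_uniq.
have nit : i \notin t.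
  by rewrite in_take ?mem_nth // index_uniq ?enum_uniq // ltnn.
rewrite (map_comp ev (at_var f)); have [a ->] := span x.
rewrite mulr_sumr (eq_bigr (fun b => ev (at_var f i * a b) * m b)); last first.
  by move=> b _; rewrite rmorphM mulrA.
move=> /ideal_coordinates aP; apply/ideal_coordinates => b.
exact: at_var_regular (aP b).
Qed.

Let phi : {rmorphism k -> R} := ev \o @mpolyC n k.

Let gens : seq R := [seq ev 'X_i | i <- enum 'I_n] ++ [seq m b | b <- enum B].

Lemma ring_generated : generated_by phi gens.
Proof.
move=> C C0 Cz CD CM.
have Cev p : C (ev p).
  elim/mpoly_generated: p => [c|i|p q Cp Cq|p q Cp Cq]; first exact: C0.
  - by apply: Cz; rewrite mem_cat; apply/orP; left; apply: map_f; rewrite mem_enum.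
  - by rewrite rmorphD; apply: CD.
  - by rewrite rmorphM; apply: CM.
move=> x; have [a ->] := span x; elim/big_rec: _ => [|b y _ Cy].
  by rewrite -(rmorph0 ev).
apply: CD => //; apply: CM => //; apply: Cz.
by rewrite mem_cat; apply/orP; right; apply: map_f; rewrite mem_enum.
Qed.

(** A chain of primes of R_P longer than n provides n + 1 elements of R which are
    independent in R_P, but n + 1 elements of R are always dependent. *)
Lemma prime_chain_localization_leq (P : prime_idealr R) d
    (c : 'I_d.+1 -> prime_idealr (localization P)) : prime_chain c -> (d <= n)%N.
Proof.
move=> cP; rewrite leqNgt; apply/negP => ltnd.
pose c' (i : nat) := c (inord i).
pose loc : {rmorphism R -> localization P} := @Localization.tolocal R P.
have step (i : 'I_n.+1) : exists x : R,
    [/\ {subset c' i <= c' i.+1}, loc x \in c' i.+1 & loc x \notin c' i].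
  have lti : (i < d)%N by rewrite (leq_trans _ ltnd) // ltnS -ltnS.
  have [|sub [y yin ynin]] := cP (inord i) (inord i.+1).
    by rewrite !inordK ?ltnS // ltnW.
  have [s [x [Ps xE]]] := tolocal_frac y; exists x.
  have {}xE : y * loc s = loc x by []; split=> //.
    by rewrite -xE mulrC idealMr.
  rewrite -xE prime_idealrM negb_or ynin /=; apply/negP => cs.
  have [v sv] := tolocal_unit Ps.
  suff : 1 \in c' i by rewrite idealr1.
  by rewrite -sv mulrC idealMr.
have [x xP] := choice step.
have [b c0|N [q [[f /eqP nzq] qE]]] :=
    algebraic_dependence (ev := phi) (rho := rho) x _ rho_injective.
  by rewrite /= rhoK.
apply: nzq.
apply: (prime_chain_independent (phi := loc \o phi) (c := c') (y := loc \o x)) => //.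
transitivity (loc (\sum_f phi (q f) * \prod_j x j ^+ f j)); last by rewrite qE rmorph0.
rewrite rmorph_sum; apply: eq_bigr => g _; rewrite rmorphM rmorph_prod.
by congr (_ * _); apply: eq_bigr => j _; rewrite rmorphXn.
Qed.

Theorem triangularly_free_cohen_macaulay : cohen_macaulay R.
Proof.
split.
  apply: fg_ideals_noetherian.
  exact: fg_ideals_generated (@fg_ideals_field k) ring_generated.
move=> M maxM.
have mon i : exists g : {poly k}, g \is monic /\ (map_poly phi g).[ev 'X_i] \in M.
  by have [g gm gM] := maximal_ideal_monic ring_generated maxM (ev 'X_i); exists g.
have [f fP] := choice mon.
have sE : size [seq ev (at_var f i) | i <- enum 'I_n] = n.
  by rewrite size_map size_enum_ord.
apply: (weakly_regular_localization_cohen_macaulay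
  (s := [seq ev (at_var f i) | i <- enum 'I_n])).
- by apply: at_var_weakly_regular => i; case: (fP i).
- move=> _ /mapP[i _ ->]; have [_] := fP i.
  by rewrite /at_var -horner_map -map_poly_comp.
- by move=> d c cP; rewrite sE; apply: prime_chain_localization_leq cP.
Qed.

End TriangularlyFree.

(** * Facets and antichains *)

(** The graph is seen through the coordinates (part, colour) of the vertices, with
    inverse X; z is the distinguished part, joined to each of the other parts by
    a Herzog-Hibi graph. *)
Section CliqueColouredGraph.
Variables (V : finType) (e : rel V) (I : eqType) (n : nat) (z : I).
Variables (part : V -> I) (col : V -> 'I_n) (X : I -> 'I_n -> V).
Hypotheses (e_sym : ssrbool.symmetric e) (e_irr : irreflexive e).
Hypotheses (XK : forall v, X (part v) (col v) = v).
Hypotheses (part_X : forall a i, part (X a i) = a) (col_X : forall a i, col (X a i) = i).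
Hypothesis e_part : forall u v, part u = part v -> ~~ e u v.
Hypothesis e_complete : forall u v,
  part u != z -> part v != z -> part u != part v -> e u v.
Hypothesis e_diag : forall u, part u != z -> e u (X z (col u)).
Hypothesis e_le : forall u j, part u != z -> e u (X z j) -> (col u <= j)%N.
Hypothesis e_trans : forall u v j, part u != z -> part u = part v ->
  e u (X z (col v)) -> e v (X z j) -> e u (X z j).

(** The partial order that the Herzog-Hibi graph between a part and z defines on
    that part; vertices of different parts, or of z, are not comparable. *)
Definition below u v := [&& part v != z, part u == part v & e u (X z (col v))].

Lemma below_refl v : part v != z -> below v v.
Proof. by move=> pv; rewrite /below pv eqxx e_diag. Qed.

Lemma below_trans : transitive below.
Proof.
move=> v u w /and3P[pv /eqP uv euv] /and3P[pw /eqP vw evw].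
rewrite /below pw uv vw eqxx; apply: e_trans euv evw => //.
by rewrite uv.
Qed.

Lemma below_col u v : below u v -> (col u <= col v)%N.
Proof. by move=> /and3P[pv /eqP uv euv]; apply: e_le euv; rewrite uv. Qed.

Lemma below_col_eq u v : below u v -> col u = col v -> u = v.
Proof. by move=> /and3P[_ /eqP puv _] cuv; rewrite -(XK u) puv cuv XK. Qed.

Lemma below_anti u v : below u v -> below v u -> u = v.
Proof.
move=> buv bvu; apply: (below_col_eq buv); apply/val_inj/eqP.
by rewrite /= eqn_leq !below_col.
Qed.

Definition upper (C : {set V}) := [set v | [exists u in C, below u v]].

Lemma upperP (C : {set V}) v :
  reflect (exists2 u, u \in C & below u v) (v \in upper C).
Proof. by rewrite inE; apply: exists_inP. Qed.

Lemma upperS (C D : {set V}) : C \subset D -> upper C \subset upper D.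
Proof.
move=> /subsetP sCD; apply/subsetP => v /upperP[u uC buv].
by apply/upperP; exists u => //; apply: sCD.
Qed.

(** Antichains are confined to a single part, other than z. The empty set is the
    one attached to the facet formed by the part z. *)
Definition antichain (C : {set V}) :=
  [&& [forall u in C, part u != z],
      [forall u in C, forall v in C, part u == part v] &
      [forall u in C, forall v in C, below u v ==> (u == v)]].

Lemma antichainP (C : {set V}) : reflect
  [/\ forall u, u \in C -> part u != z,
      forall u v, u \in C -> v \in C -> part u = part v &
      forall u v, u \in C -> v \in C -> below u v -> u = v] (antichain C).
Proof.
apply: (iffP and3P) => [[/forall_inP Cz /forall_inP Cp /forall_inP Cb]|[Cz Cp Cb]].
  split=> // u v uC vC.
    by have /forall_inP/(_ v vC)/eqP := Cp u uC.
  by have /forall_inP/(_ v vC)/implyP Cuv := Cb u uC => /Cuv/eqP.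
split; first exact/forall_inP.
  by apply/forall_inP => u uC; apply/forall_inP => v vC; apply/eqP/Cp.
apply/forall_inP => u uC; apply/forall_inP => v vC; apply/implyP => buv.
exact/eqP/Cb.
Qed.

Definition facet (C : {set V}) :=
  [set v | if part v == z then ~~ [exists u in C, e u v] else v \in upper C].

Lemma facet_base C v : part v = z -> (v \in facet C) = ~~ [exists u in C, e u v].
Proof. by move=> pv; rewrite inE pv eqxx. Qed.

Lemma facet_top C v : part v != z -> (v \in facet C) = (v \in upper C).
Proof. by move=> pv; rewrite in_set (negbTE pv). Qed.

Lemma facet_independent C u v :
  antichain C -> u \in facet C -> v \in facet C -> ~~ e u v.
Proof.
move=> /antichainP[Cz Cp _].
wlog pu : u v / part u != z => [wlogH uF vF|].
  have [pu|pu] := eqVneq (part u) z; last exact: wlogH.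
  have [pv|pv] := eqVneq (part v) z; last by rewrite e_sym wlogH.
  by apply: e_part; rewrite pu pv.
rewrite facet_top // => /upperP[w wC /and3P[_ /eqP wu ewu]].
have [pv|pv] := eqVneq (part v) z.
  rewrite facet_base //; apply: contra => euv; apply/exists_inP; exists w => //.
  rewrite -(XK v) pv; apply: e_trans ewu _ => //; first exact: Cz.
  by rewrite -pv XK.
rewrite facet_top // => /upperP[w' w'C /and3P[_ /eqP w'v _]].
by apply: e_part; rewrite -wu -w'v; apply: Cp.
Qed.

(** This is what makes the facets retract theta_i onto t_i. The vertex v0 is the
    vertex of z of colour i, unless i is the colour of an element above C, in
    which case it is this element. *)
Lemma facet_col C i : antichain C ->
  exists v0, forall v, (v \in facet C) && (col v == i) = (v == v0).
Proof.
move=> /antichainP[Cz Cp _].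
have [/exists_inP[u uC eui]|noC] := boolP [exists u in C, e u (X z i)].
  have pu := Cz u uC; exists (X (part u) i) => v; apply/andP/eqP => [[vF /eqP cv]|->].
    have [pv|pv] := eqVneq (part v) z.
      move: vF; rewrite facet_base // => /exists_inP[]; exists u => //.
      by rewrite -(XK v) pv cv.
    move: vF; rewrite facet_top // => /upperP[w wC /and3P[_ /eqP wv _]].
    by rewrite -(XK v) cv -wv (Cp _ _ wC uC).
  rewrite col_X facet_top ?part_X //; split=> //; apply/upperP; exists u => //.
  by rewrite /below part_X col_X pu eqxx.
exists (X z i) => v; apply/andP/eqP => [[vF /eqP cv]|->].
  have [pv|pv] := eqVneq (part v) z; first by rewrite -(XK v) pv cv.
  move: vF; rewrite facet_top // => /upperP[w wC /and3P[_ _ ewv]].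
  by case/exists_inP: noC; exists w; rewrite // -cv.
by rewrite col_X facet_base ?part_X.
Qed.

Lemma antichain_sub_facet C : antichain C -> C \subset facet C.
Proof.
move=> /antichainP[Cz _ _]; apply/subsetP => u uC.
rewrite facet_top ?Cz //; apply/upperP; exists u => //.
by apply: below_refl; apply: Cz.
Qed.

(** If D lies in the facet of C, then D is above C, so the up-closure of D is
    contained in that of C; if they are equal, both antichains are the set of
    its minimal elements. *)
Lemma antichain_eq C D : antichain C -> antichain D -> D \subset facet C ->
  (#|upper C| <= #|upper D|)%N -> D = C.
Proof.
move=> aC aD /subsetP DF leCD.
have [Cz _ Cb] := antichainP _ aC; have [Dz _ Db] := antichainP _ aD.
have DU u : u \in D -> u \in upper C by move=> uD; rewrite -facet_top ?Dz // DF.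
have sub : upper D \subset upper C.
  apply/subsetP => v /upperP[u /DU/upperP[w wC bwu] buv].
  by apply/upperP; exists w => //; apply: below_trans buv.
have UE : upper D = upper C by apply/eqP; rewrite eqEcard sub.
have CU u : u \in C -> u \in upper D.
  by move=> uC; rewrite UE -facet_top ?Cz //; apply: (subsetP (antichain_sub_facet aC)).
apply/setP => u; apply/idP/idP => [uD|uC].
  have /upperP[w wC bwu] := DU u uD; have /upperP[x xD bxw] := CU w wC.
  have xu : x = u by apply: Db => //; apply: below_trans bwu.
  by rewrite xu in bxw; rewrite -(below_anti bwu bxw).
have /upperP[w wD bwu] := CU u uC; have /upperP[x xC bxw] := DU w wD.
have xu : x = u by apply: Cb => //; apply: below_trans bwu.
by rewrite xu in bxw; rewrite -(below_anti bwu bxw).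
Qed.

Definition minimal (T : {set V}) :=
  [set v in T | (part v != z) && [forall w in T, below w v ==> (w == v)]].

Lemma minimalP (T : {set V}) v : reflect
  [/\ v \in T, part v != z & forall w, w \in T -> below w v -> w = v]
  (v \in minimal T).
Proof.
rewrite inE; apply: (iffP and3P) => [[vT pv /forall_inP mv]|[vT pv mv]]; split=> //.
  by move=> w /mv/implyP mwv /mwv/eqP.
by apply/forall_inP => w wT; apply/implyP => bwv; apply/eqP/mv.
Qed.

Lemma minimal_sub (T : {set V}) : minimal T \subset T.
Proof. by apply/subsetP => v /minimalP[]. Qed.

(** Below any element of T lies a minimal one, for instance one of least colour
    since the order refines that of the colours. *)
Lemma upper_minimal (T : {set V}) : upper (minimal T) = upper T.
Proof.
apply/eqP; rewrite eqEsubset upperS ?minimal_sub //=.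
apply/subsetP => v /upperP[u uT buv].
have pu : part u != z by case/and3P: buv => pv /eqP ->.
pose P w := (w \in T) && below w u.
have Pu : P u by rewrite /P uT below_refl.
case: (arg_minnP (fun w => col w : nat) Pu) => w /andP[wT bwu] wmin.
apply/upperP; exists w; last exact: below_trans buv.
apply/minimalP; split=> //; first by case/and3P: bwu => _ /eqP ->.
move=> x xT bxw; apply: (below_col_eq bxw); apply/val_inj/eqP.
rewrite /= eqn_leq below_col //= wmin // /P xT.
exact: below_trans bwu.
Qed.

Lemma minimal_antichain (T : {set V}) :
  (forall u v, u \in T -> v \in T -> ~~ e u v) -> antichain (minimal T).
Proof.
move=> indT; apply/antichainP; split.
- by move=> u /minimalP[].
- move=> u v /minimalP[uT pu _] /minimalP[vT pv _]; apply/eqP.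
  by apply: contraNT (indT u v uT vT); apply: e_complete.
- by move=> u v /minimalP[uT _ _] /minimalP[_ _ mv]; apply: mv.
Qed.

(** This is what replacing a vertex v of T by another vertex w of the same colour
    does: either w is adjacent to C, or it enlarges the up-closure of T. *)
Lemma exchange (T C : {set V}) v w :
  (forall u u', u \in T -> u' \in T -> ~~ e u u') -> C \subset T ->
  upper C = upper T -> v \in T -> w != v -> col w = col v ->
  (exists2 u, u \in C & e u w) \/ (part w != z /\ w \notin upper T).
Proof.
move=> indT /subsetP CT UE vT neq cwv.
have vU : part v != z -> v \in upper C.
  by move=> pv; rewrite UE; apply/upperP; exists v => //; apply: below_refl.
have nep : part w != part v.
  by apply: contra neq => /eqP pwv; rewrite -(XK w) pwv cwv XK.
have [pw|pw] := eqVneq (part w) z.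
  rewrite pw eq_sym in nep; have /upperP[u uC /and3P[_ _ euv]] := vU nep.
  by left; exists u => //; rewrite -(XK w) pw cwv.
right; split=> //; rewrite -UE; apply/upperP => -[u uC /and3P[_ /eqP puw euw]].
have [pv|pv] := eqVneq (part v) z.
  have := indT _ _ (CT _ uC) vT; rewrite -(XK v) pv -cwv.
  by rewrite euw.
have /upperP[u' u'C /and3P[_ /eqP pu'v _]] := vU pv.
have := indT _ _ (CT _ uC) (CT _ u'C).
by rewrite e_complete ?puw ?pu'v.
Qed.

(** * The edge ring *)

Section EdgeRing.
Variable k : fieldType.
Notation S := {mpoly k[#|V|]}.
Notation A := {mpoly k[n]}.
Notation Iedge := (edge_ideal k e).
Notation R := {ideal_quot Iedge}.

Let var v : S := 'X_(enum_rank v).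

Definition theta (i : 'I_n) : S := \sum_(v | col v == i) var v.

Definition antichain_monomial (C : {set V}) : S := \prod_(v in C) var v.

Lemma edge_in_ideal u v (p : S) : e u v -> var u * var v * p \in Iedge.
Proof.
move=> euv; rewrite mulrC; apply: idealMr; apply/asboolP.
by apply: mem_ideal_span; exists u, v.
Qed.

Lemma facet_map_exists (C : {set V}) : exists g : {rmorphism S -> A},
  (forall c, g c%:MP = c%:MP) /\
  forall v, g (var v) = if v \in facet C then 'X_(col v) else 0.
Proof.
exists (mmap (@mpolyC n k)
  (fun j => if enum_val j \in facet C then 'X_(col (enum_val j)) else 0)).
by split=> [c|v]; [rewrite /= mmapC | rewrite /= mmapX mmap1U enum_rankK].
Qed.

(** The substitution that kills the vertices outside the facet of C sends the
    product of the ends of an edge to 0, because the facet is independent. *)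
Lemma facet_retraction C : antichain C -> exists rho : {rmorphism R -> A},
  (forall c, rho (\pi_R c%:MP) = c%:MP) /\
  forall v, rho (\pi_R (var v)) = if v \in facet C then 'X_(col v) else 0.
Proof.
move=> aC; have [g [gC gX]] := facet_map_exists C.
have [|rho rhoE] := @rmorphism_quot_factor _ _ Iedge g.
  move=> x /asboolP[s sG ->].
  rewrite rmorph_sum big_seq big1 // => c /sG[u [v [euv ->]]].
  rewrite !rmorphM -/(var u) -/(var v) !gX.
  case: ifP => [uF|_]; last by rewrite mul0r mulr0.
  case: ifP => [vF|_]; last by rewrite !mulr0.
  by have := facet_independent aC uF vF; rewrite euv.
by exists rho; split=> [c|v]; rewrite rhoE.
Qed.

Let eval_theta : {rmorphism A -> S} := mmap (@mpolyC #|V| k) theta.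

Lemma theta_map_exists : exists ev : {rmorphism A -> R},
  (forall c, ev c%:MP = \pi_R c%:MP) /\ forall i, ev 'X_i = \pi_R (theta i).
Proof.
exists (\pi_R \o eval_theta).
by split=> [c|i]; rewrite /= /eval_theta /= ?mmapC // mmapX mmap1U.
Qed.

Let Basis := {C : {set V} | antichain C}.

Section Span.
Variable ev : {rmorphism A -> R}.
Hypothesis evC : forall c, ev c%:MP = \pi_R c%:MP.
Hypothesis evX : forall i, ev 'X_i = \pi_R (theta i).

Let spanned (p : S) := exists a : Basis -> A,
  \pi_R p = \sum_b ev (a b) * \pi_R (antichain_monomial (val b)).

Local Lemma spannedD p q : spanned p -> spanned q -> spanned (p + q).
Proof.
move=> [a pE] [b qE]; exists (fun c => a c + b c).
rewrite rmorphD /= pE qE -big_split; apply: eq_bigr => c _.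
by rewrite rmorphD mulrDl.
Qed.

Local Lemma spanned_mul p q f : \pi_R q = ev f -> spanned p -> spanned (q * p).
Proof.
move=> qE [a pE]; exists (fun c => f * a c).
rewrite rmorphM /= qE pE mulr_sumr; apply: eq_bigr => c _.
by rewrite rmorphM mulrA.
Qed.

Local Lemma spanned_ideal p : p \in Iedge -> spanned p.
Proof.
move=> Ip; exists (fun=> 0); rewrite big1 => [|b _]; last by rewrite rmorph0 mul0r.
by apply/eqP; rewrite -(rmorph0 \pi_R) -Quotient.idealrBE subr0.
Qed.

Local Lemma spannedN p : spanned p -> spanned (- p).
Proof.
move=> sp; rewrite -mulN1r; apply: (spanned_mul (f := -1)) sp.
by rewrite !rmorphN !rmorph1.
Qed.

Local Lemma spanned_sum (J : finType) (P : pred J) (F : J -> S) :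
  (forall j, P j -> spanned (F j)) -> spanned (\sum_(j | P j) F j).
Proof.
move=> sF; elim/big_rec: _ => [|j p Pj sp]; last by apply: spannedD => //; apply: sF.
by apply: spanned_ideal; apply: idealr0.
Qed.

Local Lemma spanned_antichain C : antichain C -> spanned (antichain_monomial C).
Proof.
move=> aC; pose b : Basis := Sub C aC.
exists (fun c => if c == b then 1 else 0); rewrite (bigD1 b) //= eqxx rmorph1 mul1r.
by rewrite big1 ?addr0 // => c /negbTE ->; rewrite rmorph0 mul0r.
Qed.

Let supp (m : 'X_{1..#|V|}) := [set v | m (enum_rank v) != 0%N].

Let U v : 'X_{1..#|V|} := U_(enum_rank v)%MM.

Local Lemma mem_suppD m v w : (w \in supp (m + U v)) = (w \in supp m) || (w == v).
Proof.
rewrite !inE mnmDE mnm1E (inj_eq enum_rank_inj) addn_eq0 negb_and.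
by rewrite eqb0 negbK [v == w]eq_sym.
Qed.

Local Lemma split_supp m v : v \in supp m -> exists m', m = (m' + U v)%MM.
Proof. by rewrite inE -lep1mP => le; exists (m - U v)%MM; rewrite submK. Qed.

Local Lemma edge_monomial_in m u v :
  e u v -> u \in supp m -> v \in supp m -> 'X_[m] \in Iedge.
Proof.
move=> euv /split_supp[m' ->]; rewrite mem_suppD => /orP[/split_supp[m'' ->]|/eqP vu].
  rewrite !mpolyXD mulrC mulrCA mulrC.
  exact: edge_in_ideal.
by rewrite vu e_irr in euv.
Qed.

(** Either x^m is the product of C, or some variable can be removed from it
    without losing C from its support. *)
Local Lemma monomial_or_split m (C : {set V}) : C \subset supp m ->
  'X_[m] = antichain_monomial C \/
  exists v m', [/\ m = (m' + U v)%MM, v \in supp m & C \subset supp m'].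
Proof.
move=> /subsetP CT.
have [/forallP mE|] := boolP [forall v, m (enum_rank v) == (v \in C)].
  left; rewrite mpolyXE_id (reindex (@enum_rank V)) /=; last exact/onW_bij/enum_rank_bij.
  rewrite /antichain_monomial [RHS]big_mkcond; apply: eq_bigr => v _.
  by rewrite (eqP (mE v)); case: (v \in C).
rewrite negb_forall => /existsP[v mv].
have vT : v \in supp m.
  rewrite inE; apply: contra mv => /eqP mv0; rewrite mv0.
  by case: (boolP (v \in C)) => // /CT; rewrite inE mv0.
right; have [m' mE] := split_supp vT; exists v, m'; split=> //.
apply/subsetP => u uC; have := CT u uC; rewrite {1}mE mem_suppD => /orP[//|/eqP uv].
rewrite inE; apply: contra mv => /eqP m'0.
by rewrite uv in uC m'0; rewrite mE mnmDE m'0 mnm1E eqxx uC.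
Qed.

(** Lexicographic induction on the size of the complement of the up-closure of the
    support, then on the degree. *)
Local Lemma spanned_monomial m : spanned 'X_[m].
Proof.
have [d] := ubnP (#|V| - #|upper (supp m)|).
elim: d m => // d IHd m; rewrite ltnS.
have [l] := ubnP (mdeg m); elim: l m => // l IHl m; rewrite ltnS => ml md.
have [/existsP[u /existsP[v /and3P[uT vT euv]]]|ind] :=
    boolP [exists u, exists v, [&& u \in supp m, v \in supp m & e u v]].
  by apply: spanned_ideal; apply: edge_monomial_in euv uT vT.
have {ind} indT u v : u \in supp m -> v \in supp m -> ~~ e u v.
  move=> uT vT; apply: contra ind => euv.
  by apply/existsP; exists u; apply/existsP; exists v; rewrite uT vT.
have aC := minimal_antichain indT; have CT := minimal_sub (supp m).
have UE := upper_minimal (supp m).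
have [->|[v [m' [mE vT CT']]]] := monomial_or_split CT; first exact: spanned_antichain.
have UE' : upper (supp m') = upper (supp m).
  apply/eqP; rewrite eqEsubset -{2}UE !upperS // mE.
  by apply/subsetP => u uT; rewrite mem_suppD uT.
(* m' has the same up-closure as m and a smaller degree, and each m' + U w
   contains an edge or has a larger up-closure. *)
have -> : 'X_[m] = theta (col v) * 'X_[m'] -
    \sum_(w | (col w == col v) && (w != v)) 'X_[m' + U w].
  rewrite (eq_bigr (fun w => var w * 'X_[m'])) => [|w _]; last by rewrite mpolyXD mulrC.
  by rewrite mE mpolyXD /theta (bigD1 v) //= mulrDl mulr_suml addrK mulrC.
apply: spannedD.
  apply: (spanned_mul (f := 'X_(col v))); first by rewrite evX.
  apply: IHl; last by rewrite UE'.
  by rewrite mE mdegD mdeg1 addn1 in ml.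
apply: spannedN; apply: spanned_sum => w /andP[/eqP cwv neq].
have wT : w \in supp (m' + U w) by rewrite mem_suppD eqxx orbT.
have sT' : supp m' \subset supp (m' + U w).
  by apply/subsetP => u uT; rewrite mem_suppD uT.
have [[u uC euw]|[pw nwU]] := exchange indT CT UE vT neq cwv.
  apply: spanned_ideal; apply: edge_monomial_in euw _ wT.
  by apply: (subsetP sT'); apply: (subsetP CT').
apply: IHd.
have ltU : (#|upper (supp m)| < #|upper (supp (m' + U w))|)%N.
  rewrite -UE'; apply: proper_card; apply/properP; split; first exact: upperS.
  exists w; last by rewrite UE'.
  by apply/upperP; exists w => //; apply: below_refl.
apply: leq_trans md; apply: ltn_sub2l => //.
exact: leq_trans ltU (max_card _).
Qed.

Lemma edge_ring_spanned (x : R) : exists a : Basis -> A,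
  x = \sum_b ev (a b) * \pi_R (antichain_monomial (val b)).
Proof.
elim/quotW: x => p; elim/mpolyind: p => [|c m p _ _ sp].
  by apply: spanned_ideal; apply: idealr0.
apply: spannedD => //; rewrite -mul_mpolyC.
by apply: (spanned_mul (f := c%:MP)); [rewrite evC | apply: spanned_monomial].
Qed.

End Span.

Theorem edge_ring_cohen_macaulay : cohen_macaulay_graph k e.
Proof.
have [ev [evC evX]] := theta_map_exists.
have rho_ex (b : Basis) := facet_retraction (valP b).
have [rho rhoP] := choice rho_ex.
have rho_theta b i : rho b (\pi_R (theta i)) = 'X_i.
  have [_ rX] := rhoP b; have [v0 v0P] := facet_col i (valP b).
  rewrite /theta !rmorph_sum /= (eq_bigr _ (fun v _ => rX v)) -big_mkcondr /=.
  rewrite (eq_bigl (pred1 v0)) => [|v]; last by rewrite /= -v0P andbC.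
  by rewrite big_pred1_eq; have := v0P v0; rewrite eqxx => /andP[_ /eqP ->].
have rho_mono b C : rho b (\pi_R (antichain_monomial C)) =
    \prod_(v in C) (if v \in facet (val b) then 'X_(col v) else 0).
  have [_ rX] := rhoP b; rewrite /antichain_monomial !rmorph_prod.
  by apply: eq_bigr => v _; rewrite rX.
apply: (@triangularly_free_cohen_macaulay k n R ev Basis
  (fun b => \pi_R (antichain_monomial (val b))) rho (fun b => #|upper (val b)|)).
- move=> b p; elim/mpoly_generated: p => [c|i|p q IHp IHq|p q IHp IHq].
  + by rewrite evC; have [-> _] := rhoP b.
  + by rewrite evX rho_theta.
  + by rewrite !rmorphD IHp IHq.
  + by rewrite !rmorphM IHp IHq.
- move=> b; rewrite rho_mono; apply/prodf_neq0 => v vb.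
  rewrite (subsetP (antichain_sub_facet (valP b))) //.
  by rewrite -msupp_eq0 msuppX.
- move=> b b' neb leb; rewrite rho_mono.
  have [sub|] := boolP (val b' \subset facet (val b)).
    by case/eqP: neb; apply: val_inj; apply: antichain_eq => //; apply: valP.
  move=> /subsetPn[v vb' nvF].
  by rewrite (bigD1 v) //= (negbTE nvF) mul0r.
- exact: edge_ring_spanned.
Qed.

End EdgeRing.

End CliqueColouredGraph.

(** * The theorem *)

Theorem theorem4p10 (k : fieldType) (V : finType) (e : rel V) (r n : nat)
    (P : 'I_r -> {set V}) (X : 'I_r -> 'I_n -> V) :
  (2 <= r)%N ->
  simple_graph e ->
  multipartite e P ->
  (forall a, #|P a| = n) ->
  (forall a, labels (P a) (X a)) ->
  (forall a b : 'I_r, (a < r.-1)%N -> (b < r.-1)%N -> a <> b ->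
    forall u v, u \in P a -> v \in P b -> e u v) ->
  (forall a z : 'I_r, (a < r.-1)%N -> z = r.-1 :> nat ->
    herzog_hibi e (P a) (P z) (X a) (X z)) ->
  cohen_macaulay_graph k e.
Proof.
move=> r2 [e_sym e_irr] [Pcover Pdisj Pind] _ lab complete hh.
have ltr : (r.-1 < r)%N by rewrite prednK // (ltn_trans _ r2).
pose z := Ordinal ltr.
have zE (a : 'I_r) : a != z -> (a < r.-1)%N.
  move=> nz; rewrite ltn_neqAle -[r.-1]/(val z) val_eqE nz /= -ltnS.
  by rewrite prednK // (ltn_trans _ r2).
have XP a i : X a i \in P a by have [_ ->] := lab a; apply: imset_f.
have Puniq a b v : v \in P a -> v \in P b -> a = b.
  move=> va vb; apply: contraTeq (vb) => /Pdisj/disjointFr; move/(_ _ va) => ->.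
  by [].
have lab_ex v : exists p : 'I_r * 'I_n, X p.1 p.2 = v.
  have : v \in \bigcup_a P a by rewrite Pcover inE.
  move=> /bigcupP[a _]; have [_ ->] := lab a => /imsetP[i _ ->].
  by exists (a, i).
have [f fK] := choice lab_ex.
have Pf v : v \in P (f v).1 by rewrite -{1}(fK v).
have part_X a i : (f (X a i)).1 = a by apply: Puniq (Pf _) (XP a i).
have col_X a i : (f (X a i)).2 = i.
  have [X_inj _] := lab a; apply: X_inj.
  by rewrite -[in RHS](fK (X a i)) part_X.
apply: (@edge_ring_cohen_macaulay V e 'I_r n z
  (fun v => (f v).1) (fun v => (f v).2) X) => //.
- by move=> u v uv; apply: (Pind (f u).1) => //; rewrite uv.
- move=> u v /zE pu /zE pv /eqP neq.
  by apply: complete neq _ _ _ _; rewrite ?Pf.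
- move=> u /zE pu; have [_ diag _ _] := hh _ z pu erefl.
  by have := diag (f u).2; rewrite fK.
- move=> u j /zE pu; have [_ _ le _] := hh _ z pu erefl.
  by have := le (f u).2 j; rewrite fK.
- move=> u v j /zE pu puv; have [_ _ _ tr] := hh _ z pu erefl.
  by have := tr (f u).2 (f v).2 j; rewrite fK puv fK.
Qed.
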